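(* Let $n \geq 3$. Then almost all Lagrangian torus orbits of the standard Hamiltonian $T^n$-action on $(\mathbb{C}P^n,\omega_{\mathrm{FS}},J_{\mathrm{std}})$ are not Hamiltonian volume minimizing; that is, there is an open dense subset $D\subset \mathrm{Int}(\Delta)$ such that for every $p\in D$ the Lagrangian torus $\mu^{-1}(p)\subset \mathbb{C}P^n$ is not Hamiltonian volume minimizing.
   Context: $\mathbb{C}P^n$ carries its standard complex structure $J_{\mathrm{std}}$, the standard Fubini–Study Kähler form $\omega_{\mathrm{FS}}$ (normalized as below), and the associated Kähler metric. The standard $T^n$-action $(e^{\sqrt{-1}t_1},\dots,e^{\sqrt{-1}t_n})\cdot[z_0:z_1:\cdots:z_n]=[z_0:e^{\sqrt{-1}t_1}z_1:\cdots:e^{\sqrt{-1}t_n}z_n]$ is Hamiltonian with moment map $$\mu([z_0:\cdots:z_n])=\left(\frac{|z_1|^2}{\sum_{k=0}^n|z_k|^2},\dots,\frac{|z_n|^2}{\sum_{k=0}^n|z_k|^2}\right),$$ whose image is $\Delta=\{(a_1,\dots,a_n)\in(\mathbb{R}_{\ge0})^n \mid \sum_{i=1}^n a_i\le 1\}$. The normalization of $\omega_{\mathrm{FS}}$ is such that $\omega_{\mathrm{FS}}=\sum_{i=1}^n du^i\wedge d\theta^i$ where all $z_k\neq0$, with $u^i$ the components of $\mu$ and $\theta^i=\arg(z_i/z_0)$. The principal orbits of the action are exactly the fibres $\mu^{-1}(p)$, $p\in\mathrm{Int}(\Delta)$ (the interior of $\Delta$); each is a Lagrangian torus, and these are the ''Lagrangian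 torus orbits''. Let $(M,\omega,J)$ be a Kähler manifold. A diffeomorphism $\phi$ of $M$ belongs to $\mathrm{Ham}_c(M,\omega)$ if it is the time-one map of the flow $\{\phi^t_H\}_{0\le t\le 1}$, $\phi_H^0=\mathrm{id}_M$, of the time-dependent Hamiltonian vector field $X_{H_t}$ of some compactly supported smooth function $H\in C_c^\infty([0,1]\times M)$. For a closed embedded Lagrangian submanifold $L\subset M$, $\mathrm{Vol}(L)$ denotes its Riemannian volume for the metric induced from $M$. $L$ is called Hamiltonian volume minimizing if $\mathrm{Vol}(\phi(L))\ge \mathrm{Vol}(L)$ for every $\phi\in\mathrm{Ham}_c(M,\omega)$. *)

(* Defs.v *)
From HB Require Import structures.
From mathcomp Require Import all_boot all_order all_algebra generic_quotient.
From mathcomp Require Import complex ring.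
From mathcomp Require Import all_classical all_reals all_analysis.

Set Implicit Arguments.
Unset Strict Implicit.
Unset Printing Implicit Defensive.

Import Order.TTheory GRing.Theory Num.Theory.
Import numFieldNormedType.Exports.

Local Open Scope classical_set_scope.
Local Open Scope ring_scope.
Local Open Scope quotient_scope.

(** Smoothness is tested on all iterated directional derivatives; for
    finite-dimensional [V] and open [U] this is the usual notion.  The values
    of [f] outside of [U] are irrelevant. *)
Fixpoint Ck_on (R : realType) (V W : normedModType R) (k : nat) (U : set V)
    (f : V -> W) : Prop :=
  (forall x, U x -> {for x, continuous f}) /\
  (if k is k'.+1 then
     forall v, (forall x, U x -> derivable f x v) /\
               Ck_on k' U (fun x => 'D_v f x)
   else True).

Definition smooth_on (R : realType) (V W : normedModType R) (U : set V)
    (f : V -> W) : Prop := forall k, Ck_on k U f.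

(** [z : cvec R n] encodes the vector [z.1 + sqrt(-1) z.2] of C^(n+1), as an
    element of a normed module over [R]. *)
Definition cvec (R : realType) (n : nat) : normedModType R :=
  ('rV[R]_n.+1 * 'rV[R]_n.+1)%type.

Section ProjectiveSpace.
Variables (R : realType) (n : nat).
Implicit Types (z w u v : cvec R n) (l m : R[i]).

Definition cscale l z : cvec R n :=
  (complex.Re l *: z.1 - complex.Im l *: z.2,
   complex.Re l *: z.2 + complex.Im l *: z.1).

Lemma cscale1 z : cscale 1 z = z.
Proof. by case: z => x y; rewrite /cscale /= !scale1r !scale0r subr0 addr0. Qed.

Lemma cscaleA l m z : cscale l (cscale m z) = cscale (l * m) z.
Proof.
case: l m z => [a b] [c d] [x y]; rewrite /cscale /=.
by congr (_, _); apply/rowP => i; rewrite !mxE; ring.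
Qed.

Lemma cscale0 z : cscale 0 z = 0.
Proof. by rewrite /cscale /= !scale0r subr0 addr0. Qed.

Definition nzvec : Type := {z : cvec R n | z != 0}.

Definition collinear (z w : nzvec) : bool :=
  `[< exists l, val w = cscale l (val z) >].

Lemma collinear_equiv : equiv_class_of collinear.
Proof.
split=> [z|z w|w z t].
- by apply/asboolP; exists 1; rewrite cscale1.
- wlog suff H : z w / collinear z w -> collinear w z.
    by apply/idP/idP; exact: H.
  move=> /asboolP[l wE]; apply/asboolP; exists l^-1.
  have l0 : l != 0.
    by apply/eqP => l0; move: (valP w); rewrite wE l0 cscale0 eqxx.
  by rewrite wE cscaleA mulVf // cscale1.
- move=> /asboolP[l wE] /asboolP[m tE]; apply/asboolP; exists (m * l).
  by rewrite tE wE cscaleA.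
Qed.

Canonical collinear_eqrel := EquivRelPack collinear_equiv.

Definition CP := {eq_quot collinear_eqrel}.
HB.instance Definition _ := Choice.on CP.
HB.instance Definition _ := EqQuotient.on CP.

Lemma const1_neq0 : (const_mx 1, 0) != 0 :> cvec R n.
Proof.
apply/eqP => -[/matrixP/(_ 0 0)]; rewrite !mxE => /eqP.
by rewrite oner_eq0.
Qed.

(** [pt z] is the point of homogeneous coordinates [z]; its value at [z = 0]
    is irrelevant. *)
Definition pt z : CP :=
  \pi_CP (insubd (Sub (const_mx 1, 0) const1_neq0 : nzvec) z).

Lemma pt_eqP z w : z != 0 -> w != 0 ->
  (pt z = pt w) <-> exists l, w = cscale l z.
Proof.
move=> z0 w0; rewrite /pt; split.
- by move=> /eqmodP/asboolP; rewrite !val_insubd z0 w0.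
- by move=> H; apply/eqmodP/asboolP; rewrite !val_insubd z0 w0.
Qed.

Lemma pt_repr (q : CP) : pt (val (repr q)) = q.
Proof.
rewrite /pt -[RHS]reprK; congr (\pi _); apply: val_inj.
by rewrite val_insubd (valP (repr q)).
Qed.

Definition cnorm2 z (k : 'I_n.+1) : R := z.1 0 k ^+ 2 + z.2 0 k ^+ 2.

Definition moment (q : CP) : 'rV[R]_n :=
  let z : cvec R n := val (repr q) in
  \row_(i < n) (cnorm2 z (lift ord0 i) / \sum_(k < n.+1) cnorm2 z k).

Lemma cnorm2_cscale l z k :
  cnorm2 (cscale l z) k = (complex.Re l ^+ 2 + complex.Im l ^+ 2) * cnorm2 z k.
Proof. by rewrite /cnorm2 /cscale !mxE; ring. Qed.

Lemma moment_pt z : z != 0 ->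
  moment (pt z) =
  \row_(i < n) (cnorm2 z (lift ord0 i) / \sum_(k < n.+1) cnorm2 z k).
Proof.
move=> z0; have [|l zE] := (pt_eqP (valP (repr (pt z))) z0).1.
  exact: pt_repr.
have l0 : complex.Re l ^+ 2 + complex.Im l ^+ 2 != 0.
  apply/eqP => /eqP; rewrite paddr_eq0 ?sqr_ge0// !sqrf_eq0 => /andP[/eqP a /eqP b].
  move: z0; rewrite zE; have -> : l = 0 by case: l a b {zE} => ? ? /= -> ->.
  by rewrite cscale0 eqxx.
apply/rowP => i; rewrite !mxE; rewrite [in RHS]zE.
under [in RHS]eq_bigr do rewrite cnorm2_cscale.
by rewrite cnorm2_cscale -mulr_sumr -mulf_div divff // mul1r.
Qed.

Definition simplex : set 'rV[R]_n :=
  [set a | (forall i, 0 <= a 0 i) /\ \sum_(i < n) a 0 i <= 1].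

(** Tangent vectors of CP^n at [pt z] are represented by vectors of C^(n+1)
    modulo the complex line spanned by [z].  With the Hermitian product <,>
    linear in the first variable, the metric below is
      2 Re ((<u,v><z,z> - <u,z><z,v>) / <z,z>^2).
    The factor 2 gives the normalization omega_FS = sum_i du^i /\ dtheta^i:
    at [1:0:...:0] both sides are 2 sum_i dx^i /\ dy^i in the affine
    coordinates x^i + sqrt(-1) y^i = z_i / z_0. *)
Definition cdot u v : R :=
  \sum_(k < n.+1) (u.1 0 k * v.1 0 k + u.2 0 k * v.2 0 k).

Definition fs_metric z u v : R :=
  2 * (cdot u v * cdot z z - cdot u z * cdot z v
       - cdot u (cscale 'i%C z) * cdot (cscale 'i%C z) v) / cdot z z ^+ 2.

Definition fs_form z u v : R := fs_metric z (cscale 'i%C u) v.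

(** The projection C^(n+1) \ {0} -> CP^n is a surjective submersion, so that a
    function on CP^n is smooth iff its pull-back is, and a map to CP^n is
    smooth iff it lifts locally to smooth nonvanishing homogeneous
    coordinates. *)
Definition smooth_to_CP (V : normedModType R) (U : set V) (f : V -> CP) :=
  forall x, U x -> exists (W : set V) (F : V -> cvec R n),
    [/\ open W, W x, smooth_on W F &
        forall y, W y -> F y != 0 /\ f y = pt (F y)].

Definition smooth_map (phi : CP -> CP) : Prop :=
  smooth_to_CP [set z : cvec R n | z != 0] (phi \o pt).

Definition diffeomorphism (phi : CP -> CP) : Prop :=
  smooth_map phi /\
  exists psi, [/\ smooth_map psi, cancel phi psi & cancel psi phi].

(** A smooth function on [0,1] x CP^n is the restriction of a smooth function
    on R x CP^n.  Compactness of the support is automatic. *)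
Definition smooth_hamiltonian (H : R -> CP -> R) : Prop :=
  smooth_on [set tz : R * cvec R n | tz.2 != 0] (fun tz => H tz.1 (pt tz.2)).

(** The velocity of the curve [c] at time [t] is the tangent vector at [pt z]
    represented by [w]. *)
Definition velocity (c : R -> CP) (t : R) z w : Prop :=
  exists C : R -> cvec R n,
    [/\ \forall s \near t, C s != 0 /\ c s = pt (C s),
        C t = z & is_derive t 1 C w].

(** Convention omega(X_H, .) = dH; the opposite one replaces [H] by [-H] and
    yields the same group. *)
Definition hamiltonian_flow (H : R -> CP -> R) (Phi : R -> CP -> CP) : Prop :=
  (forall q, Phi 0 q = q) /\
  forall q t, 0 <= t <= 1 -> exists z w,
    velocity (Phi^~ q) t z w /\
    forall v, fs_form z w v = 'D_v (fun y => H t (pt y)) z.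

Definition Ham (phi : CP -> CP) : Prop :=
  diffeomorphism phi /\
  exists (H : R -> CP -> R) (Phi : R -> CP -> CP),
    [/\ smooth_hamiltonian H, hamiltonian_flow H Phi & Phi 1 = phi].

End ProjectiveSpace.
Arguments simplex : clear implicits.


Section Volume.
Variables (R : realType).

(** Lebesgue integral over R^d of a nonnegative Borel function, as an iterated
    integral (Tonelli). *)
Fixpoint integral_Rn (d : nat) : ('rV[R]_d -> \bar R) -> \bar R :=
  match d with
  | 0 => fun f => f 0
  | d'.+1 => fun f =>
      (\int[@lebesgue_measure R]_x
        integral_Rn (fun y : 'rV[R]_d' => f (row_mx x%:M y : 'rV_(1 + d'))))%E
  end.

Definition borel_Rn (d : nat) (E : set 'rV[R]_d) : Prop :=
  <<s [set U : set 'rV[R]_d | open U] >> E.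

Definition gram (n d : nat) (F : 'rV[R]_d -> cvec R n) (x : 'rV[R]_d) :
    'M[R]_d :=
  \matrix_(i, j) fs_metric (F x) ('D_(delta_mx 0 i) F x) ('D_(delta_mx 0 j) F x).

(** [v] is the Riemannian volume of the compact [d]-dimensional submanifold
    [L] of CP^n: [L] is partitioned into finitely many pieces [pt (F k x)],
    [x \in E k], where [E k] is a Borel subset of the domain [U k] of an
    immersion [pt \o F k] into [L] which is injective on [E k], and the volume
    of each piece is the integral over [E k] of the square root of the Gram
    determinant of the induced metric.  By the change of variables formula, [v]
    does not depend on the choices. *)
Definition is_volume (n d : nat) (L : set (CP R n)) (v : \bar R) : Prop :=
  exists (N : nat) (U E : 'I_N -> set 'rV[R]_d)
         (F : 'I_N -> 'rV[R]_d -> cvec R n),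
    [/\ forall k, [/\ open (U k), borel_Rn (E k) & E k `<=` U k],
        forall k, smooth_on (U k) (F k) /\
          forall x, U k x ->
            [/\ F k x != 0, L (pt (F k x)) & 0 < \det (gram (F k) x)],
        forall q, L q <->
          exists kx : 'I_N * 'rV[R]_d, E kx.1 kx.2 /\ q = pt (F kx.1 kx.2),
        forall (k l : 'I_N) x y, E k x -> E l y ->
          pt (F k x) = pt (F l y) -> (k, x) = (l, y) &
        v = (\sum_(k < N) integral_Rn (fun x =>
               if x \in E k then (Num.sqrt (\det (gram (F k) x)))%:E else 0))%E].

(** Lagrangian submanifolds of CP^n have real dimension [n]. *)
Definition hamiltonian_volume_minimizing (n : nat) (L : set (CP R n)) : Prop :=
  forall phi, Ham phi -> forall v w,
    is_volume n L v -> is_volume n (phi @` L) w -> (v <= w)%E.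

End Volume.

(* Main.v *)
(** In homogeneous moment coordinates [u_0, ..., u_n] (positive, of sum 1) the
    volume of the orbit over [u] is a constant times the square root of the
    product of the [u_m].  Assume [u_i < u_j < u_l < u_k].  The segment through
    [u] in the direction [e_i - e_j + e_k - e_l] meets the boundary of the
    simplex transversally in the facets [u_i = 0] and [u_j = 0]: it is a
    symmetric probe.  Reducing by the complementary (n-1)-torus gives a sphere on
    which the orbits over [u] and over its mirror image
      [u_i' = u_j, u_j' = u_i, u_k' = u_k + d, u_l' = u_l - d]  ([d = u_j - u_i])
    are circles of opposite heights, exchanged by a half turn about a horizontal
    axis.  The Hamiltonian of this rotation is
    [Re (z_i * z_j^* * z_k * z_l^* / (|z_k| |z_l|))] divided by [|z|^2]; cut off
    by a function of the conserved quantities [u_k - u_i] and [u_l - u_j] it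
    becomes smooth on CP^n, and its flow remains explicit.  Since
      [u_k' u_l' = u_k u_l - d (u_k + d - u_l)],
    the new orbit has smaller volume.  Four distinct coordinates suffice, so the
    argument applies on an open dense set. *)

From HB Require Import structures.
From mathcomp Require Import all_boot all_order all_algebra.
From mathcomp Require Import complex ring lra.
From mathcomp Require Import all_classical all_reals all_analysis.
Require Import Defs.

Import Order.TTheory GRing.Theory Num.Theory.
Import numFieldNormedType.Exports.

Local Open Scope classical_set_scope.
Local Open Scope ring_scope.

Set Implicit Arguments.
Unset Strict Implicit.
Unset Printing Implicit Defensive.

(** * Iterated differentiability *)

(** The obstacle is to produce a Hamiltonian diffeomorphism without solving a differential equation.
    The phase of z_k z_l^* is singular where z_k z_l = 0. Where the gaps u_k - u_i and u_l - u_j are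
    both at least a positive constant, u_k and u_l are positive, so a cutoff supported there removes
    the singularity. The order of the four coordinates makes both gaps positive on the given torus.
    A cutoff that is constant along orbits only rescales time and adds torus rotations at constant
    rates: hence the closed form of the flow. Its group law then transports the velocity from time 0
    to any time and supplies the inverse map. The reduced sphere is the Hopf quotient of the pair
    (w, z_j), with w the coordinate z_i multiplied by that phase. A half turn of the sphere is
    therefore a rotation of the pair by the angle pi / 2, and the height of the cutoff is tuned to
    reach this angle at time 1. Minimality is a statement about all values [v], [w] accepted by
    [is_volume], so one explicit chart for each of the two tori is enough to refute it. *)

Section Smoothness.
Context {R : realType}.
Implicit Types (V W : normedModType R).

(* Asking for Frechet differentiability at every order makes products and
   compositions differentiable by induction, which [Ck_on] alone does not. *)
Fixpoint iter_diff_on V W (k : nat) (U : set V) (f : V -> W) : Prop :=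
  (forall x, U x -> differentiable f x) /\
  (if k is k'.+1 then
     forall v, exists2 g, (forall x, U x -> 'D_v f x = g x) &
                          iter_diff_on k' U g
   else True).

Lemma iter_diff_onW V W k (U : set V) (f : V -> W) :
  iter_diff_on k.+1 U f -> iter_diff_on k U f.
Proof.
elim: k f => [|k IH] f [df Df]; split=> // v.
by have [g fg Dg] := Df v; exists g => //; exact: IH.
Qed.

Lemma Ck_on_eq V W k (U : set V) (f g : V -> W) : open U ->
  (forall x, U x -> f x = g x) -> Ck_on k U g -> Ck_on k U f.
Proof.
move=> oU; elim: k f g => [|k IH] f g fg [cg Dg].
all: have fgn x : U x -> \near x, g x = f x by
  move=> Ux; apply: filterS (open_nbhs_nbhs (conj oU Ux)) => y /fg.
all: have cf x : U x -> {for x, continuous f} by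
  move=> Ux; rewrite /prop_for /continuous_at (fg _ Ux);
  apply: cvg_trans (cg _ Ux); apply: near_eq_cvg; exact: fgn.
  by split.
split=> // v; have [dg Dvg] := Dg v; split=> [x Ux|].
  by apply: near_eq_derivable (dg _ Ux); exact: fgn.
apply: IH Dvg => x Ux; apply/esym/near_eq_derive; exact: fgn.
Qed.

(** Needed because the Hamiltonian is smooth for different reasons on two overlapping open sets. *)
Lemma Ck_on_local V W k (U : set V) (f : V -> W) :
  (forall x, U x -> exists O, [/\ open O, O x & Ck_on k O f]) -> Ck_on k U f.
Proof.
elim: k f => [|k IH] f H; split=> [x /H[N [_ Ox [c _]]]|] //; try exact: c.
move=> v; split=> [x /H[N [_ Ox [_ /(_ v)[c _]]]]|]; first exact: c.
by apply: IH => x /H[N [oN Ox [_ /(_ v)[_ ?]]]]; exists N.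
Qed.

Lemma iter_diff_on_Ck V W k (U : set V) (f : V -> W) : open U ->
  iter_diff_on k U f -> Ck_on k U f.
Proof.
move=> oU; elim: k f => [|k IH] f [df Df]; split=> [x Ux|] //.
- exact/differentiable_continuous/df.
- exact/differentiable_continuous/df.
- move=> v; have [g fg Dg] := Df v; split=> [x Ux|].
    exact/diff_derivable/df.
  by apply: Ck_on_eq fg _ => //; exact: IH.
Qed.

Lemma iter_diff_on_cst V W k (U : set V) (w : W) : iter_diff_on k U (cst w).
Proof.
elim: k w => [|k IH] w; split=> // v; exists (cst 0) => // x _.
by rewrite derive_cst.
Qed.

Lemma iter_diff_onD V W k (U : set V) (f g : V -> W) :
  iter_diff_on k U f -> iter_diff_on k U g ->
  iter_diff_on k U (fun x => f x + g x).
Proof.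
elim: k f g => [|k IH] f g [df Df] [dg Dg].
  by split=> // x Ux; apply: differentiableD; [exact: df|exact: dg].
split=> [x Ux|v]; first by apply: differentiableD; [exact: df|exact: dg].
have [f' ff' Df'] := Df v; have [g' gg' Dg'] := Dg v.
exists (fun x => f' x + g' x); last exact: IH.
move=> x Ux; rewrite -ff'// -gg'//; apply: deriveD.
  exact/diff_derivable/df.
exact/diff_derivable/dg.
Qed.

Lemma iter_diff_on_sum V W k (U : set V) (I : Type) (r : seq I) (P : pred I)
    (f : I -> V -> W) : (forall i, P i -> iter_diff_on k U (f i)) ->
  iter_diff_on k U (fun x => \sum_(i <- r | P i) f i x).
Proof.
move=> H; elim: r => [|i r IH].
  suff -> : (fun x => \sum_(i <- [::] | P i) f i x) = cst 0.
    exact: iter_diff_on_cst.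
  by apply/funext => x; rewrite big_nil.
have -> : (fun x => \sum_(j <- i :: r | P j) f j x) = fun x =>
    if P i then f i x + \sum_(j <- r | P j) f j x else \sum_(j <- r | P j) f j x.
  by apply/funext => x; rewrite big_cons.
by case: (boolP (P i)) => // Pi; apply: iter_diff_onD => //; exact: H.
Qed.

Lemma iter_diff_onM V k (U : set V) (f g : V -> R) :
  iter_diff_on k U f -> iter_diff_on k U g ->
  iter_diff_on k U (fun x => f x * g x).
Proof.
elim: k f g => [|k IH] f g [df Df] [dg Dg].
  by split=> // x Ux; apply: differentiableM; [exact: df|exact: dg].
split=> [x Ux|v]; first by apply: differentiableM; [exact: df|exact: dg].
have [f' ff' Df'] := Df v; have [g' gg' Dg'] := Dg v.
exists (fun x => f x * g' x + g x * f' x).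
  move=> x Ux; rewrite -ff'// -gg'//; apply: deriveM.
    exact/diff_derivable/df.
  exact/diff_derivable/dg.
by apply: iter_diff_onD; apply: IH => //; exact: iter_diff_onW.
Qed.

Lemma iter_diff_onZl V W k (U : set V) (f : V -> R) (w : W) :
  iter_diff_on k U f -> iter_diff_on k U (fun x => f x *: w).
Proof.
elim: k f => [|k IH] f [df Df];
    have dfw x (Ux : U x) := @differentiableZl R V W f w x (df _ Ux).
  by [].
split=> // v; have [f' ff' Df'] := Df v; exists (fun x => f' x *: w); last exact: IH.
move=> x Ux; rewrite -ff'// deriveE; last exact: dfw.
by rewrite deriveE; [rewrite diffZl//; exact: df|exact: df].
Qed.

Lemma iter_diff_onN V k (U : set V) (f : V -> R) :
  iter_diff_on k U f -> iter_diff_on k U (fun x => - f x).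
Proof.
move=> Df; have -> : (fun x => - f x) = fun x => cst (-1) x * f x.
  by apply/funext => x; rewrite mulN1r.
by apply: iter_diff_onM => //; exact: iter_diff_on_cst.
Qed.

Lemma iter_diff_onB V k (U : set V) (f g : V -> R) :
  iter_diff_on k U f -> iter_diff_on k U g ->
  iter_diff_on k U (fun x => f x - g x).
Proof. by move=> Df Dg; apply: iter_diff_onD => //; exact: iter_diff_onN. Qed.

Lemma iter_diff_on_lin V W k (U : set V) (f : V -> W) :
  linear f -> continuous f -> iter_diff_on k U f.
Proof.
move=> lf cf.
pose f' : {linear V -> W} := HB.pack f (GRing.isLinear.Build _ _ _ _ _ lf).
have df x : differentiable f x := @linear_differentiable R V W f' x cf.
case: k => [|k]; split=> // v; exists (cst (f v)); last exact: iter_diff_on_cst.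
by move=> x _; rewrite deriveE//= (@diff_lin R V W f' x cf).
Qed.

Lemma iter_diff_on_lincomp V V' W k (U : set V) (f : V -> W) (L : V' -> V) :
  linear L -> continuous L -> iter_diff_on k U f ->
  iter_diff_on k (L @^-1` U) (f \o L).
Proof.
move=> lL cL.
pose L' : {linear V' -> V} := HB.pack L (GRing.isLinear.Build _ _ _ _ _ lL).
have dL x : differentiable L x := @linear_differentiable R V' V L' x cL.
elim: k f => [|k IH] f [df Df];
    have dfL x (Ux : U (L x)) : differentiable (f \o L) x :=
      differentiable_comp (dL x) (df _ Ux).
  by [].
split=> // v; have [f' ff' Df'] := Df (L v); exists (f' \o L); last exact: IH.
move=> x Ux; rewrite /= -ff'// deriveE; last exact: dfL.
rewrite deriveE; last exact: df.
by rewrite diff_comp//=; [rewrite (@diff_lin R V' V L' x cL)|exact: df].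
Qed.

(** The outer function lives on R, so its derivative in direction 1 is the only one involved: the
    derivative of the composite is a product to which the induction applies. *)
Lemma iter_diff_on_comp V k (U : set V) (O : set R) (g : R -> R) (f : V -> R) :
  (forall x, U x -> O (f x)) -> iter_diff_on k O g -> iter_diff_on k U f ->
  iter_diff_on k U (fun x => g (f x)).
Proof.
move=> UO; elim: k f g UO => [|k IH] f g UO [dg Dg] [df Df].
  by split=> // x Ux; apply: differentiable_comp; [exact: df|exact/dg/UO].
split=> [x Ux|v]; first by apply: differentiable_comp; [exact: df|exact/dg/UO].
have [g' gg' Dg'] := Dg 1; have [f' ff' Df'] := Df v.
exists (fun x => f' x * g' (f x)); last first.
  apply: iter_diff_onM => //; apply: IH => //.
  exact: iter_diff_onW.
move=> x Ux.
have dfx := df _ Ux; have dgx := dg _ (UO _ Ux).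
rewrite -[X in 'D_v X x]/(g \o f) -ff'// -gg'//; last exact: UO.
rewrite !deriveE//; last exact: differentiable_comp.
rewrite diff_comp//= -[in LHS](mulr1 ('d f x v)).
by rewrite -[_ * 1]/(_ *: (1 : R)) linearZ.
Qed.

End Smoothness.

(** * Directional derivatives by restriction to lines *)

Section DirectionalDerivatives.
Context {R : realType} {V : normedModType R}.
Implicit Types (f g : V -> R) (z v : V).

(** Restriction to a line opens the one-variable chain rule to functions known only to have a
    derivative in the direction [v]. *)
Lemma is_derive_line f z v (d : R) :
  is_derive (0 : R) (1 : R) (fun h : R => f (h *: v + z)) d -> is_derive z v f d.
Proof.
move=> [dh <-].
have E : (fun h : R => h^-1 *: (((fun h : R => f (h *: v + z)) \o shift 0) (h *: (1 : R))
      - f (0 *: v + z))) = (fun h => h^-1 *: ((f \o shift z) (h *: v) - f z)).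
  by apply/funext => h; rewrite /= addr0 scale0r add0r -[h *: 1]/(h * 1) mulr1.
by apply: DeriveDef; [move: dh|]; rewrite /derivable /derive E.
Qed.

Lemma is_derive_linecomp f z v (d : R) :
  is_derive z v f d -> is_derive (0 : R) (1 : R) (fun h : R => f (h *: v + z)) d.
Proof.
move=> [dh <-].
have E : (fun h : R => h^-1 *: (((fun h : R => f (h *: v + z)) \o shift 0) (h *: (1 : R))
      - f (0 *: v + z))) = (fun h => h^-1 *: ((f \o shift z) (h *: v) - f z)).
  by apply/funext => h; rewrite /= addr0 scale0r add0r -[h *: 1]/(h * 1) mulr1.
by apply: DeriveDef; [move: dh|]; rewrite /derivable /derive E.
Qed.

Lemma is_derive_comp1 (g : R -> R) f z v (df dg : R) :
  is_derive z v f df -> is_derive (f z) (1 : R) g dg ->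
  is_derive z v (fun x => g (f x)) (dg * df).
Proof.
move=> /is_derive_linecomp Df Dg; apply: is_derive_line.
apply: (@is_derive1_comp _ g (fun h : R => f (h *: v + z))) => //.
by rewrite scale0r add0r.
Qed.

Lemma is_derive_congr f z v (d d' : R) :
  is_derive z v f d -> d = d' -> is_derive z v f d'.
Proof. by move=> Df <-. Qed.

Lemma is_derive_plus f g z v (df dg : R) :
  is_derive z v f df -> is_derive z v g dg ->
  is_derive z v (fun x => f x + g x) (df + dg).
Proof. exact: is_deriveD. Qed.

Lemma is_derive_opp f z v (df : R) :
  is_derive z v f df -> is_derive z v (fun x => - f x) (- df).
Proof. exact: is_deriveN. Qed.

Lemma is_derive_times f g z v (df dg : R) :
  is_derive z v f df -> is_derive z v g dg ->
  is_derive z v (fun x => f x * g x) (df * g z + f z * dg).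
Proof.
move=> Df Dg; apply: is_derive_eq (is_deriveM Df Dg) _.
by rewrite addrC mulrC.
Qed.

Lemma is_derive_inv f z v (df : R) : f z != 0 ->
  is_derive z v f df -> is_derive z v (fun x => (f x)^-1) (- (f z)^-2 * df).
Proof.
move=> fz0 [Df <-]; apply: DeriveDef; first exact: derivableV.
by rewrite deriveV.
Qed.

Lemma is_derive_sqrt f z v (df : R) : 0 < f z ->
  is_derive z v f df ->
  is_derive z v (fun x => Num.sqrt (f x)) ((2 * Num.sqrt (f z))^-1 * df).
Proof.
by move=> fz0 Df; apply: is_derive_comp1; exact: is_derive1_sqrt.
Qed.

Lemma is_derive_cos_comp f z v (df : R) :
  is_derive z v f df ->
  is_derive z v (fun x => cos (f x)) (- sin (f z) * df).
Proof. by move=> Df; apply: is_derive_comp1; exact: is_derive_cos. Qed.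

Lemma is_derive_sin_comp f z v (df : R) :
  is_derive z v f df ->
  is_derive z v (fun x => sin (f x)) (cos (f z) * df).
Proof. by move=> Df; apply: is_derive_comp1; exact: is_derive_sin. Qed.

End DirectionalDerivatives.

(** * Real coordinates on C^(n+1) *)

Section Coordinates.
Context {R : realType} {n : nat}.
Implicit Types (z w v : cvec R n) (m : 'I_n.+1).

Lemma continuous_re m : continuous (fun z => z.1 0 m).
Proof.
move=> z; apply: (@continuous_comp _ _ _ fst (fun x : 'rV[R]_n.+1 => x 0 m)).
  exact: cvg_fst.
exact: coord_continuous.
Qed.

Lemma continuous_im m : continuous (fun z => z.2 0 m).
Proof.
move=> z; apply: (@continuous_comp _ _ _ snd (fun x : 'rV[R]_n.+1 => x 0 m)).
  exact: cvg_snd.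
exact: coord_continuous.
Qed.

Lemma linear_re m : linear (fun z => z.1 0 m).
Proof. by move=> a u v; rewrite !mxE. Qed.

Lemma linear_im m : linear (fun z => z.2 0 m).
Proof. by move=> a u v; rewrite !mxE. Qed.

Lemma iter_diff_on_re k U m : iter_diff_on k U (fun z => z.1 0 m).
Proof. by apply: iter_diff_on_lin; [exact: linear_re|exact: continuous_re]. Qed.

Lemma iter_diff_on_im k U m : iter_diff_on k U (fun z => z.2 0 m).
Proof. by apply: iter_diff_on_lin; [exact: linear_im|exact: continuous_im]. Qed.

Lemma is_derive_re m z v : is_derive z v (fun z => z.1 0 m) (v.1 0 m).
Proof.
apply: is_derive_line.
have -> : (fun h : R => (h *: v + z).1 0 m) =
    (fun h => h * v.1 0 m + cst (z.1 0 m) h) by apply/funext => h; rewrite !mxE.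
apply: is_derive_eq (is_derive_plus (is_derive_times _ _) _) _.
by rewrite mul1r mulr0 !addr0.
Qed.

Lemma is_derive_im m z v : is_derive z v (fun z => z.2 0 m) (v.2 0 m).
Proof.
apply: is_derive_line.
have -> : (fun h : R => (h *: v + z).2 0 m) =
    (fun h => h * v.2 0 m + cst (z.2 0 m) h) by apply/funext => h; rewrite !mxE.
apply: is_derive_eq (is_derive_plus (is_derive_times _ _) _) _.
by rewrite mul1r mulr0 !addr0.
Qed.

Definition re_basis m : cvec R n := (delta_mx 0 m, 0).
Definition im_basis m : cvec R n := (0, delta_mx 0 m).

Lemma cvec_basis z :
  z = \sum_m z.1 0 m *: re_basis m + \sum_m z.2 0 m *: im_basis m.
Proof.
have fstE (f : 'I_n.+1 -> cvec R n) : (\sum_m f m).1 = \sum_m (f m).1.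
  exact: (big_morph fst).
have sndE (f : 'I_n.+1 -> cvec R n) : (\sum_m f m).2 = \sum_m (f m).2.
  exact: (big_morph snd).
rewrite [LHS]surjective_pairing [RHS]surjective_pairing /=.
rewrite !fstE !sndE /= [X in _ + X]big1 => [|m _]; last by rewrite scaler0.
rewrite addr0 [X in X + _]big1 => [|m _]; last by rewrite scaler0.
rewrite add0r; congr (_, _); apply/rowP => m; rewrite summxE (bigD1 m)//= big1.
- by rewrite !mxE !eqxx mulr1 addr0.
- by move=> m' m'm; rewrite !mxE eq_sym (negbTE m'm) andbF mulr0.
- by rewrite !mxE !eqxx mulr1 addr0.
- by move=> m' m'm; rewrite !mxE eq_sym (negbTE m'm) andbF mulr0.
Qed.

Lemma iter_diff_on_cvec (V : normedModType R) k (U : set V) (F : V -> cvec R n) :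
  (forall m, iter_diff_on k U (fun x => (F x).1 0 m)) ->
  (forall m, iter_diff_on k U (fun x => (F x).2 0 m)) -> iter_diff_on k U F.
Proof.
move=> D1 D2.
have -> : F = fun x => \sum_m (F x).1 0 m *: re_basis m +
                       \sum_m (F x).2 0 m *: im_basis m.
  by apply/funext => x; rewrite -cvec_basis.
apply: iter_diff_onD; apply: iter_diff_on_sum => m _; exact: iter_diff_onZl.
Qed.

Lemma is_derive_scalel (V W : normedModType R) (f : V -> R) (w : W) (x v : V) (d : R) :
  is_derive x v f d -> is_derive x v (fun y => f y *: w) (d *: w).
Proof.
move=> [df <-].
have E : (fun h : R => h^-1 *: (((fun y => f y *: w) \o shift x) (h *: v) - f x *: w)) =
    (fun h : R => (h^-1 *: ((f \o shift x) (h *: v) - f x)) *: w).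
  by apply/funext => h; rewrite /= -scalerBl scalerA.
have cv : h^-1 *: (((fun y => f y *: w) \o shift x) (h *: v) - f x *: w) @[h --> 0^']
    --> 'D_v f x *: w.
  by rewrite E; apply: cvgZr_tmp.
by apply: DeriveDef; [apply/cvg_ex; exists ('D_v f x *: w)|exact/cvg_lim].
Qed.

Lemma is_derive_cvec (V : normedModType R) (F : V -> cvec R n) (x v : V) w :
  (forall m, is_derive x v (fun x => (F x).1 0 m) (w.1 0 m)) ->
  (forall m, is_derive x v (fun x => (F x).2 0 m) (w.2 0 m)) ->
  is_derive x v F w.
Proof.
move=> D1 D2.
have -> : F = (\sum_m (fun x => (F x).1 0 m *: re_basis m)) +
              (\sum_m (fun x => (F x).2 0 m *: im_basis m)).
  by apply/funext => y; rewrite [LHS]cvec_basis fctE !fct_sumE.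
rewrite (cvec_basis w).
by apply: is_deriveD; apply: is_derive_sum => m; exact: is_derive_scalel.
Qed.

End Coordinates.

(* [notypeclasses] because the instances of [is_derive] on the ring of
   functions would otherwise be selected, with [*:] in the derivatives. *)
Ltac is_derive_step := first
  [ eassumption
  | notypeclasses refine (is_derive_cst _ _ _)
  | notypeclasses refine (is_derive_id _ _)
  | notypeclasses refine (is_derive_re _ _ _)
  | notypeclasses refine (is_derive_im _ _ _)
  | notypeclasses refine (is_derive_cos_comp _)
  | notypeclasses refine (is_derive_sin_comp _)
  | notypeclasses refine (is_derive_plus _ _)
  | notypeclasses refine (is_derive_opp _)
  | notypeclasses refine (is_derive_times _ _) ].

Ltac is_derive_tac :=
  notypeclasses refine (is_derive_congr _ _); [by repeat is_derive_step|cbv beta].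

(** * Smooth functions of one real variable *)

Section UnivariateSmoothness.
Context {R : realType}.

(** On R the derivative in direction [v] is [v] times a single function, which turns the smoothness
    of each function below into an induction on the order. *)
Lemma iter_diff_on_real k (D : set R) (f f' : R -> R) :
  (forall x, D x -> is_derive x 1 f (f' x)) -> iter_diff_on k D f' ->
  iter_diff_on k.+1 D f.
Proof.
move=> ff' Df'.
have df x : D x -> differentiable f x.
  by move=> Dx; apply/derivable1_diffP; have [] := ff' _ Dx.
split=> // v; exists (fun x => v * f' x).
  move=> x Dx; rewrite deriveE; last exact: df.
  have [_ <-] := ff' _ Dx; rewrite deriveE; last exact: df.
  by rewrite -[in LHS](mulr1 v) -[v * 1]/(v *: (1 : R)) linearZ.
by apply: iter_diff_onM => //; exact: iter_diff_on_cst.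
Qed.

Lemma iter_diff_on_inv k : iter_diff_on k [set x : R | x != 0] (fun x => x^-1).
Proof.
have dV (x : R) : x != 0 -> is_derive x 1 (fun x => x^-1) (- (x^-1 * x^-1)).
  move=> x0; apply: is_derive_congr (is_derive_inv x0 (is_derive_id x 1)) _.
  by rewrite mulr1 -expr2 exprVn.
elim: k => [|k IH].
  by split=> // x /dV [/derivable1_diffP].
apply: iter_diff_on_real dV _.
by apply: iter_diff_onN; exact: iter_diff_onM.
Qed.

Lemma iter_diff_on_sqrt k : iter_diff_on k [set x : R | 0 < x] Num.sqrt.
Proof.
elim: k => [|k IH].
  by split=> // x /is_derive1_sqrt [/derivable1_diffP].
apply: (iter_diff_on_real (f' := fun x => (2 * Num.sqrt x)^-1)).
apply: (iter_diff_on_comp _ (iter_diff_on_inv k)) => [x /= x0|].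
  by rewrite mulf_neq0 ?pnatr_eq0// gt_eqF// sqrtr_gt0.
by apply: iter_diff_onM => //; exact: iter_diff_on_cst.
Qed.

Lemma iter_diff_on_sincos k :
  iter_diff_on k setT (@sin R) /\ iter_diff_on k setT (@cos R).
Proof.
elim: k => [|k [IHs IHc]].
  split; split=> // x _; apply/derivable1_diffP.
    by have [] := is_derive_sin x.
  by have [] := is_derive_cos x.
split; first by apply: (iter_diff_on_real _ IHc) => x _; exact: is_derive_sin.
by apply: (iter_diff_on_real _ (iter_diff_onN IHs)) => x _; exact: is_derive_cos.
Qed.

(* The derivatives of [exp (- 1 / x)] (extended by 0) are combinations of the
   [flat m], so this family is closed under differentiation. *)
Definition flat (m : nat) (x : R) : R :=
  if 0 < x then x^-1 ^+ m * expR (- x^-1) else 0.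

Lemma flat_le0 m x : x <= 0 -> flat m x = 0.
Proof. by move=> x0; rewrite /flat ltNge x0. Qed.

Lemma flat_gt0 m x : 0 < x -> 0 < flat m x.
Proof. by move=> x0; rewrite /flat x0 mulr_gt0 ?expR_gt0// exprn_gt0// invr_gt0. Qed.

(** Keep the term of degree [m.+2] of the exponential series at 1 / x. The quadratic decay makes the
    difference quotient at 0 of order |h|, which gives the derivative 0 there. *)
Lemma flat_bound m x : `|flat m x| <= (m.+2)`!%:R * x ^+ 2.
Proof.
rewrite /flat; case: ifPn => [x0|_]; last by rewrite normr0 mulr_ge0// sqr_ge0.
rewrite ger0_norm; last by rewrite mulr_ge0 ?expR_ge0// exprn_ge0// invr_ge0 ltW.
have x'0 : 0 < x^-1 by rewrite invr_gt0.
have := expR_ge1Dxn m.+1 (ltW x'0).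
rewrite expRN; set E := expR _ => leE.
have {}leE : x^-1 ^+ m.+2 / m.+2`!%:R <= E.
  by apply: le_trans leE; rewrite lerDr.
have E0 : 0 < E by exact: expR_gt0.
rewrite ler_pdivrMr// mulrAC -ler_pdivrMr; last by rewrite exprn_gt0.
have F0 : 0 < m.+2`!%:R :> R by rewrite ltr0n fact_gt0.
rewrite ler_pdivrMr// in leE.
by rewrite mulrC -exprVn -exprD (le_trans leE)// mulrC.
Qed.

Lemma is_derive_flat m (x : R) :
  is_derive x 1 (flat m) (flat m.+2 x - m%:R * flat m.+1 x).
Proof.
have [x0|x0|->] := ltgtP x 0.
- rewrite !flat_le0 ?ltW// mulr0 subr0.
  apply: (@near_eq_is_derive _ _ _ (cst 0)).
  near=> y; rewrite flat_le0// ltW//; near: y; exact: lt_nbhsl.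
- have d : is_derive x 1 (fun y : R => y^-1 ^+ m * expR (- y^-1))
      (flat m.+2 x - m%:R * flat m.+1 x).
    have dV : is_derive x 1 (fun y : R => y^-1) (- x^-2).
      apply: is_derive_congr (is_derive_inv (lt0r_neq0 x0) (is_derive_id x 1)) _.
      exact: mulr1.
    have dE : is_derive x 1 (fun y : R => expR (- y^-1)) (x^-2 * expR (- x^-1)).
      have dNV : is_derive x 1 (fun y : R => - y^-1) (x^-2).
        by rewrite -[_^-2]opprK; exact: is_deriveN.
      rewrite mulrC; exact: (@is_derive1_comp _ expR).
    have -> : (fun y : R => y^-1 ^+ m * expR (- y^-1)) =
        (fun y : R => y^-1) ^+ m * (fun y => expR (- y^-1)).
      by apply/funext => y; rewrite /= exprfctE.
    apply: (is_derive_eq (is_deriveM (is_deriveX m dV) dE)).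
    rewrite /flat x0 /GRing.scale/=.
    rewrite exprfctE -exprVn; set y := x^-1; case: (m) => [|m'].
      by rewrite expr0 !expr2 /=; ring.
    by rewrite /= !exprS; ring.
  apply: near_eq_is_derive d.
  by near=> y; rewrite /flat; case: ifPn => // /negP[]; near: y; exact: lt_nbhsr.
- rewrite !flat_le0// mulr0 subr0.
  have cv : h^-1 *: ((flat m \o shift 0) (h *: (1 : R)) - flat m 0) @[h --> 0^'] --> (0 : R).
    apply/cvgr0Pnorm_le => e e0; near=> h.
    have h0 : h != 0 by near: h; exact: nbhs_dnbhs_neq.
    have F0 : 0 < m.+2`!%:R :> R by rewrite ltr0n fact_gt0.
    rewrite flat_le0// subr0 normrZ normfV ler_pdivrMl ?normr_gt0//=.
    rewrite addr0 -[h%:A]/(h * 1) mulr1 (le_trans (flat_bound m h))//.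
    rewrite -[h ^+ 2]real_normK ?num_real// expr2 mulrA mulrC ler_pM2l ?normr_gt0//.
    rewrite -ler_pdivlMl//; near: h.
    by apply: dnbhs0_le; rewrite mulr_gt0// invr_gt0.
  by apply: DeriveDef; [apply/cvg_ex; exists 0; exact: cv|exact/cvg_lim].
Unshelve. all: by end_near. Qed.

Lemma iter_diff_on_flat k m : iter_diff_on k setT (flat m).
Proof.
elim: k m => [|k IH] m.
  by split=> // x _; apply/derivable1_diffP; have [] := is_derive_flat m x.
apply: iter_diff_on_real (fun x _ => is_derive_flat m x) _.
apply: iter_diff_onB => //.
by apply: iter_diff_onM => //; exact: iter_diff_on_cst.
Qed.

End UnivariateSmoothness.


Local Notation "x ^*" := (conjc x) : ring_scope.

(** * Complex arithmetic and a one-parameter group of rotations of C^2 *)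

Section ComplexNumbers.
Context {R : realType}.
Implicit Types (x y z : R[i]) (a b c s : R).
Local Open Scope complex_scope.

(** Real-valued, whereas the norm of [R[i]] takes its values in [R[i]]. *)
Definition sqn x : R := complex.Re x ^+ 2 + complex.Im x ^+ 2.

Definition cis a : R[i] := cos a +i* sin a.

Lemma ReM x y : complex.Re (x * y) =
  complex.Re x * complex.Re y - complex.Im x * complex.Im y.
Proof. by case: x y => [? ?] [? ?]. Qed.

Lemma ImM x y : complex.Im (x * y) =
  complex.Re x * complex.Im y + complex.Im x * complex.Re y.
Proof. by case: x y => [? ?] [? ?]. Qed.

Lemma ReD x y : complex.Re (x + y) = complex.Re x + complex.Re y.
Proof. by case: x y => [? ?] [? ?]. Qed.

Lemma ImD x y : complex.Im (x + y) = complex.Im x + complex.Im y.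
Proof. by case: x y => [? ?] [? ?]. Qed.

Lemma ReN x : complex.Re (- x) = - complex.Re x.
Proof. by case: x. Qed.

Lemma ImN x : complex.Im (- x) = - complex.Im x.
Proof. by case: x. Qed.

Lemma ReC x : complex.Re x^* = complex.Re x.
Proof. by case: x. Qed.

Lemma ImC x : complex.Im x^* = - complex.Im x.
Proof. by case: x. Qed.

Definition complexE := (ReM, ImM, ReD, ImD, ReN, ImN, ReC, ImC).

Lemma eq_complexP x y : complex.Re x = complex.Re y ->
  complex.Im x = complex.Im y -> x = y.
Proof. by case: x y => [? ?] [? ?] /= -> ->. Qed.

Lemma sqn_ge0 x : 0 <= sqn x.
Proof. by rewrite addr_ge0// sqr_ge0. Qed.

Lemma sqn_gt0 x : (0 < sqn x) = (x != 0).
Proof.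
case: x => a b; rewrite lt_neqAle sqn_ge0 andbT eq_sym /sqn/=.
by rewrite paddr_eq0 ?sqr_ge0// !sqrf_eq0 eq_complex.
Qed.

Lemma sqnM x y : sqn (x * y) = sqn x * sqn y.
Proof. by rewrite /sqn !complexE; ring. Qed.

Lemma sqnC x : sqn x^* = sqn x.
Proof. by rewrite /sqn !complexE; ring. Qed.

Lemma sqn_real a : sqn a%:C = a ^+ 2.
Proof. by rewrite /sqn/= expr0n addr0. Qed.

Lemma sqn_cis a : sqn (cis a) = 1.
Proof. exact: cos2Dsin2. Qed.

Lemma mulCconj x : x * x^* = (sqn x)%:C.
Proof. by apply: eq_complexP; rewrite !complexE /sqn/=; ring. Qed.

Lemma cisD a b : cis (a + b) = cis a * cis b.
Proof. by apply: eq_complexP; rewrite complexE /= ?cosD ?sinD//; ring. Qed.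

Lemma cis0 : cis 0 = 1.
Proof. by rewrite /cis cos0 sin0. Qed.

Lemma cisC a : (cis a)^* = cis (- a).
Proof. by rewrite /cis/= cosN sinN. Qed.

(** First component of exp(- 'i a S) applied to (x, y), where S exchanges the two components; the
    second component is [rot a y x]. These unitary maps form the flow of a multiple of Re (x y^*
    ). *)
Definition rot a x y : R[i] := (cos a)%:C * x - 'i * (sin a)%:C * y.

Lemma realCM a b : (a * b)%:C = a%:C * b%:C :> R[i].
Proof. by apply: eq_complexP; rewrite !complexE/=; ring. Qed.

Lemma conjCM x y : (x * y)^* = x^* * y^*.
Proof. by apply: eq_complexP; rewrite !complexE; ring. Qed.

Lemma ReRot a x y :
  complex.Re (rot a x y) = cos a * complex.Re x + sin a * complex.Im y.
Proof. by rewrite /rot !complexE/=; ring. Qed.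

Lemma ImRot a x y :
  complex.Im (rot a x y) = cos a * complex.Im x - sin a * complex.Re y.
Proof. by rewrite /rot !complexE/=; ring. Qed.

(** With v = y u^*, the twisted pair becomes the ordinary rotation of (x, v), up to the unit factor
    [u] on the second component. *)
Lemma rot_conj a x y (u : R[i]) : sqn u = 1 ->
  rot a y (x * u) = rot a (y * u^*) x * u.
Proof.
move=> u1; rewrite /rot mulrBl; congr (_ - _); last by ring.
by rewrite -!mulrA [u^* * u]mulrC mulCconj u1 mulr1.
Qed.

Lemma sqn_rot a x y (u : R[i]) : sqn u = 1 ->
  sqn (rot a x (y * u^*)) + sqn (rot a y (x * u)) = sqn x + sqn y.
Proof.
move=> u1; rewrite (rot_conj a x y u1) sqnM u1 mulr1.
rewrite -[in RHS](mulr1 (sqn y)) -u1 -(sqnC u) -sqnM.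
set v := y * u^*.
transitivity ((cos a ^+ 2 + sin a ^+ 2) * (sqn x + sqn v)).
  by rewrite /sqn !ReRot !ImRot; ring.
by rewrite cos2Dsin2 mul1r.
Qed.

Lemma Re_rot a x y (u : R[i]) : sqn u = 1 ->
  complex.Re (rot a x (y * u^*) * (rot a y (x * u))^* * u) =
  complex.Re (x * y^* * u).
Proof.
move=> u1; rewrite (rot_conj a x y u1) conjCM -!mulrA [u^* * u]mulrC mulCconj u1 mulr1.
have -> : y^* * u = (y * u^*)^* by rewrite conjCM conjcK.
set v := y * u^*; rewrite -[RHS]mul1r -(cos2Dsin2 a) !ReM !ReC !ImC.
by rewrite !ReRot !ImRot; ring.
Qed.

(** Group law in the form met by the flow: a first step also multiplies the two components by [e]
    and [f] and turns the phase [u] into u e^* f, so that the extra phases cancel. *)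
Lemma rot_rot a b x y u e f : sqn u = 1 -> sqn e = 1 -> sqn f = 1 ->
  rot b (e * rot a x (y * u^*)) (f * rot a y (x * u) * (u * e^* * f)^*) =
  e * rot (a + b) x (y * u^*).
Proof.
move=> u1 e1 f1; rewrite (rot_conj a x y u1).
have uu : u * u^* = 1 by rewrite mulCconj u1.
have ff : f * f^* = 1 by rewrite mulCconj f1.
set v := y * u^*.
transitivity (e * rot b (rot a x v) (rot a v x * (u * u^*) * (f * f^*))).
  by rewrite !conjCM conjcK /rot; ring.
rewrite uu ff !mulr1; congr (_ * _).
by apply: eq_complexP; rewrite !(ReRot, ImRot) cosD sinD; ring.
Qed.

Lemma rot_rot' a b x y u e f : sqn u = 1 -> sqn e = 1 -> sqn f = 1 ->
  rot b (f * rot a y (x * u)) (e * rot a x (y * u^*) * (u * e^* * f)) =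
  f * rot (a + b) y (x * u).
Proof.
move=> u1 e1 f1.
have := rot_rot a b y x (u := u^*) (e := f) (f := e).
by rewrite !sqnC conjcK => /(_ u1 f1 e1) <-; rewrite !conjCM !conjcK; congr rot; ring.
Qed.

Lemma Re_mul_conj x y u : complex.Re (x * y^* * u^*) = complex.Re (u * x^* * y).
Proof. by rewrite -ReC !conjCM !conjcK mulrC mulrA. Qed.

Lemma Im_mul_conj x y u : complex.Im (x * y^* * u^*) = - complex.Im (u * x^* * y).
Proof. by rewrite -[LHS]opprK -ImC !conjCM !conjcK mulrC mulrA. Qed.

Lemma rot0 x y : rot 0 x y = x.
Proof. by apply: eq_complexP; rewrite !(ReRot, ImRot) cos0 sin0; ring. Qed.

End ComplexNumbers.

(** * The flow *)

Lemma uniq4_neq (T : eqType) (i j k l : T) : uniq [:: i; j; k; l] ->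
  [/\ j != i, k != i & l != i] /\ [/\ k != j, l != j & l != k].
Proof.
rewrite /= !inE !negb_or => /and4P[/and3P[? ? ?] /andP[? ?] ? _].
by split; split; rewrite eq_sym.
Qed.

Section Flow.
Context {R : realType} {n : nat} (i j k l : 'I_n.+1).
Hypothesis ijkl : uniq [:: i; j; k; l].
Implicit Types (z w v : cvec R n) (m : 'I_n.+1) (x : R[i]).
Local Open Scope complex_scope.

Let ne := uniq4_neq ijkl.

Lemma sum_four (F : 'I_n.+1 -> R) :
  \sum_m F m = F i + F j + F k + F l +
    \sum_(m | [&& m != i, m != j, m != k & m != l]) F m.
Proof.
have [[ji ki li] [kj lj lk]] := ne.
rewrite (bigD1 i)//= (bigD1 j)//= (bigD1 k)/= ?ki// (bigD1 l)/= ?li ?lj//.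
by rewrite !addrA; congr (_ + _); apply: eq_bigl => m; rewrite -!andbA.
Qed.

Definition co z m : R[i] := z.1 0 m +i* z.2 0 m.

Definition of_co (f : 'I_n.+1 -> R[i]) : cvec R n :=
  (\row_m complex.Re (f m), \row_m complex.Im (f m)).

Lemma of_coK f m : co (of_co f) m = f m.
Proof. by rewrite /co /of_co /= !mxE; case: (f m). Qed.

Lemma coP z w : (forall m, co z m = co w m) -> z = w.
Proof.
case: z w => [z1 z2] [w1 w2] H; congr (_, _); apply/rowP => m.
  by have /(congr1 (@complex.Re R)) := H m.
by have /(congr1 (@complex.Im R)) := H m.
Qed.

Lemma co_cscale x z m : co (cscale x z) m = x * co z m.
Proof. by apply: eq_complexP; rewrite !complexE /= !mxE; ring. Qed.

Lemma cnorm2E z m : cnorm2 z m = sqn (co z m).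
Proof. by []. Qed.

Lemma cnorm2_ge0 z m : 0 <= cnorm2 z m.
Proof. exact: (sqn_ge0 (co z m)). Qed.

Definition nsq z : R := \sum_m cnorm2 z m.

Lemma nsq_eq0 z : (nsq z == 0) = (z == 0).
Proof.
apply/idP/eqP => [|->]; last first.
  by rewrite /nsq big1// => m _; rewrite /cnorm2/= !mxE !expr0n addr0.
rewrite psumr_eq0; last by move=> m _; exact: cnorm2_ge0.
move=> /allP H; apply: coP => m.
have := H m (mem_index_enum _); rewrite cnorm2E/= => /eqP h.
have : ~~ (0 < sqn (co z m)) by rewrite h ltxx.
rewrite sqn_gt0 negbK => /eqP ->.
by apply: eq_complexP; rewrite /= mxE.
Qed.

Lemma nsq_gt0 z : (0 < nsq z) = (z != 0).
Proof.
rewrite lt_neqAle sumr_ge0 ?andbT => [|m _]; last exact: cnorm2_ge0.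
by rewrite eq_sym nsq_eq0.
Qed.

Lemma nsq_cscale x z : nsq (cscale x z) = sqn x * nsq z.
Proof. by rewrite /nsq mulr_sumr; apply: eq_bigr => m _; rewrite cnorm2_cscale. Qed.

(** A unit phase of weight e_k - e_l, invariant under complex scaling: its product with z_i z_j^*
    has the weight e_i - e_j + e_k - e_l of the probe. *)
Definition zeta z : R[i] :=
  co z k * (co z l)^* * (Num.sqrt (cnorm2 z k * cnorm2 z l))^-1%:C.

Lemma sqn_zeta z : 0 < cnorm2 z k -> 0 < cnorm2 z l -> sqn (zeta z) = 1.
Proof.
move=> k0 l0; rewrite /zeta !sqnM sqnC sqn_real -!cnorm2E exprVn sqr_sqrtr.
  by rewrite divff// gt_eqF// mulr_gt0.
by rewrite ltW// mulr_gt0.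
Qed.

Lemma zeta_cscale x z : x != 0 -> zeta (cscale x z) = zeta z.
Proof.
rewrite -sqn_gt0 => x0; rewrite /zeta !co_cscale !cnorm2E !co_cscale !sqnM.
rewrite (_ : sqn x * _ * _ = sqn x ^+ 2 * (sqn (co z k) * sqn (co z l))); last by ring.
rewrite sqrtrM ?sqr_ge0// sqrtr_sqr ger0_norm ?sqn_ge0// invfM.
set a := (Num.sqrt _)^-1.
rewrite conjCM realCM.
transitivity (co z k * (co z l)^* * a%:C * (x * x^* * (sqn x)^-1%:C)); first ring.
rewrite mulCconj; suff -> : (sqn x)%:C * (sqn x)^-1%:C = 1 by rewrite mulr1.
apply: eq_complexP; rewrite !complexE/=; last by ring.
by field; rewrite gt_eqF.
Qed.

(* On [z_k, z_l <> 0] put [w = zeta * z_i].  In the coordinates [w], [z_j],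
   [arg z_k], [arg z_l], [|z_k|^2 - |z_i|^2], [|z_l|^2 - |z_j|^2] the Hamiltonian
   [Re (w * z_j^* )] rotates [(w, z_j)] and fixes the rest; [al] and [be] are the
   angles of the torus rotations generated by the last two coordinates.  If [z_k]
   or [z_l] is 0 the junk division is harmless: the flow then has all its angles
   equal to 0. *)
Definition twist (tau al be : R) z : cvec R n :=
  let zi := rot tau (co z i) (co z j * (zeta z)^*) in
  let zj := rot tau (co z j) (co z i * zeta z) in
  of_co (fun m =>
    if m == i then cis al * zi
    else if m == j then cis be * zj
    else if m == k then cis (- al) *
      (Num.sqrt ((cnorm2 z k - cnorm2 z i + sqn zi) / cnorm2 z k))%:C * co z k
    else if m == l then cis (- be) *
      (Num.sqrt ((cnorm2 z l - cnorm2 z j + sqn zj) / cnorm2 z l))%:C * co z l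
    else co z m).

Lemma twist_i t a b z :
  co (twist t a b z) i = cis a * rot t (co z i) (co z j * (zeta z)^*).
Proof. by rewrite of_coK eqxx. Qed.

Lemma twist_j t a b z :
  co (twist t a b z) j = cis b * rot t (co z j) (co z i * zeta z).
Proof. by have [[/negbTE ji _ _] _] := ne; rewrite of_coK ji eqxx. Qed.

Lemma twist_k t a b z : co (twist t a b z) k = cis (- a) *
  (Num.sqrt ((cnorm2 z k - cnorm2 z i +
    sqn (rot t (co z i) (co z j * (zeta z)^*))) / cnorm2 z k))%:C * co z k.
Proof.
by have [[_ /negbTE ki _] [/negbTE kj _ _]] := ne; rewrite of_coK ki kj eqxx.
Qed.

Lemma twist_l t a b z : co (twist t a b z) l = cis (- b) *
  (Num.sqrt ((cnorm2 z l - cnorm2 z j +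
    sqn (rot t (co z j) (co z i * zeta z))) / cnorm2 z l))%:C * co z l.
Proof.
have [[_ _ /negbTE li] [_ /negbTE lj /negbTE lk]] := ne.
by rewrite of_coK li lj lk eqxx.
Qed.

Lemma twist_other t a b z m : m != i -> m != j -> m != k -> m != l ->
  co (twist t a b z) m = co z m.
Proof. by rewrite of_coK => /negbTE-> /negbTE-> /negbTE-> /negbTE->. Qed.

Lemma twist0 z : twist 0 0 0 z = z.
Proof.
(* If z_m = 0, the quotient is 0 instead of 1, but it multiplies z_m itself. This makes [twist0]
   valid at every [z]. *)
have H m m' : (Num.sqrt ((cnorm2 z m - cnorm2 z m' + cnorm2 z m') / cnorm2 z m))%:C
    * co z m = co z m.
  rewrite subrK; have [z0|z0] := eqVneq (cnorm2 z m) 0; last first.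
    by rewrite divff// sqrtr1 mul1r.
  suff -> : co z m = 0 by rewrite mulr0.
  by apply/eqP; rewrite -[_ == _]negbK -sqn_gt0 -cnorm2E z0 ltxx.
apply: coP => m; rewrite of_coK !rot0 -!cnorm2E oppr0 cis0 !mul1r !H.
by do 4 (case: eqP => [->//|_]).
Qed.

(** Phases and ratios of moduli have degree 0, so [twist] is homogeneous of degree 1; this is what
    lets the flow descend to CP^n. *)
Lemma twist_cscale x t a b z : x != 0 ->
  twist t a b (cscale x z) = cscale x (twist t a b z).
Proof.
move=> x0; have := x0; rewrite -sqn_gt0 => sx0.
have rotM (u v : R[i]) : rot t (x * u) (x * v) = x * rot t u v by rewrite /rot; ring.
have H m m' u : (sqn x * cnorm2 z m - sqn x * cnorm2 z m' + sqn x * u) /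
    (sqn x * cnorm2 z m) = (cnorm2 z m - cnorm2 z m' + u) / cnorm2 z m.
  by rewrite -mulrBr -mulrDr -mulf_div divff ?mul1r// gt_eqF.
apply: coP => m; rewrite co_cscale !of_coK zeta_cscale// !co_cscale -!mulrA !rotM.
rewrite !sqnM !cnorm2_cscale !H.
by do 4 (case: eqP => [_|_]; first ring).
Qed.

(* The probe through the orbit of [z] in the direction [e_i - e_j + e_k - e_l]
   leaves the simplex through the facets [u_i = 0] and [u_j = 0]. *)
Definition ample z := cnorm2 z i < cnorm2 z k /\ cnorm2 z j < cnorm2 z l.

Lemma ample_gt0 z : ample z -> 0 < cnorm2 z k /\ 0 < cnorm2 z l.
Proof. by case=> ik jl; split; apply: le_lt_trans (cnorm2_ge0 _ _) _; eassumption. Qed.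

Section Ample.
Variables (t a b : R) (z : cvec R n).
Hypothesis az : ample z.
Let w := twist t a b z.

Let k0 := (ample_gt0 az).1.
Let l0 := (ample_gt0 az).2.

Let u1 : sqn (zeta z) = 1. Proof. exact: sqn_zeta. Qed.

Lemma cnorm2_twist_i :
  cnorm2 w i = sqn (rot t (co z i) (co z j * (zeta z)^*)).
Proof. by rewrite cnorm2E twist_i sqnM sqn_cis mul1r. Qed.

Lemma cnorm2_twist_j : cnorm2 w j = sqn (rot t (co z j) (co z i * zeta z)).
Proof. by rewrite cnorm2E twist_j sqnM sqn_cis mul1r. Qed.

Lemma cnorm2_twist_ij : cnorm2 w i + cnorm2 w j = cnorm2 z i + cnorm2 z j.
Proof. by rewrite cnorm2_twist_i cnorm2_twist_j sqn_rot. Qed.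

(** The modulus of z_k is adjusted to conserve |z_k|^2 - |z_i|^2; ampleness keeps the radicand
    nonnegative, so that squaring undoes the root. *)
Lemma cnorm2_twist_k : cnorm2 w k = cnorm2 z k - cnorm2 z i + cnorm2 w i.
Proof.
rewrite {1}cnorm2E twist_k !sqnM sqn_cis mul1r sqn_real sqr_sqrtr.
  by rewrite -cnorm2_twist_i -cnorm2E divfK// gt_eqF.
rewrite divr_ge0 ?cnorm2_ge0// addr_ge0 ?sqn_ge0// subr_ge0 ltW//.
by case: az.
Qed.

Lemma cnorm2_twist_l : cnorm2 w l = cnorm2 z l - cnorm2 z j + cnorm2 w j.
Proof.
rewrite {1}cnorm2E twist_l !sqnM sqn_cis mul1r sqn_real sqr_sqrtr.
  by rewrite -cnorm2_twist_j -cnorm2E divfK// gt_eqF.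
rewrite divr_ge0 ?cnorm2_ge0// addr_ge0 ?sqn_ge0// subr_ge0 ltW//.
by case: az.
Qed.

Lemma cnorm2_twist_other m : m != i -> m != j -> m != k -> m != l ->
  cnorm2 w m = cnorm2 z m.
Proof. by move=> *; rewrite !cnorm2E twist_other. Qed.

Lemma ample_twist : ample w.
Proof.
rewrite /ample cnorm2_twist_k cnorm2_twist_l; case: az => ik jl.
by rewrite ltrDr subr_gt0 ltrDr subr_gt0.
Qed.

Lemma nsq_twist : nsq w = nsq z.
Proof.
rewrite /nsq !sum_four cnorm2_twist_k cnorm2_twist_l; congr (_ + _); last first.
  by apply: eq_bigr => m /and4P[? ? ? ?]; rewrite cnorm2_twist_other.
by have := cnorm2_twist_ij; lra.
Qed.

(** The positive modulus factors [p], [q] cancel in a phase; only the rotations of z_k and z_l by -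
    a and - b remain. *)
Lemma zeta_twist : zeta w = zeta z * (cis a)^* * cis b.
Proof.
rewrite /zeta !cnorm2E twist_k twist_l !sqnM !sqn_cis !mul1r !sqn_real.
set p := Num.sqrt (_ / _); set q := Num.sqrt (_ / sqn (co z l)).
have p0 : 0 < p.
  rewrite sqrtr_gt0 divr_gt0// ltr_wpDr ?sqn_ge0// subr_gt0.
  by case: az.
have q0 : 0 < q.
  rewrite sqrtr_gt0 divr_gt0// ltr_wpDr ?sqn_ge0// subr_gt0.
  by case: az.
rewrite (_ : p ^+ 2 * _ * _ = (p * q) ^+ 2 * (sqn (co z k) * sqn (co z l))); last by ring.
rewrite sqrtrM ?sqr_ge0// sqrtr_sqr ger0_norm ?mulr_ge0 ?(ltW p0) ?(ltW q0)//.
rewrite invfM; set r := (Num.sqrt _)^-1.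
rewrite realCM !conjCM !cisC opprK.
transitivity (co z k * (co z l)^* * r%:C * cis (- a) * cis b *
   (p%:C * q%:C^* * (p * q)^-1%:C)); first by ring.
suff -> : p%:C * q%:C^* * (p * q)^-1%:C = 1 by rewrite mulr1; ring.
apply: eq_complexP; rewrite !complexE/=; last by ring.
by field; rewrite !gt_eqF.
Qed.

Lemma twist_add t' a' b' :
  twist t' a' b' w = twist (t + t') (a + a') (b + b') z.
Proof.
have zi : rot t' (co w i) (co w j * (zeta w)^*) =
    cis a * rot (t + t') (co z i) (co z j * (zeta z)^*).
  by rewrite twist_i twist_j zeta_twist rot_rot ?sqn_cis.
have zj : rot t' (co w j) (co w i * (zeta w)) =
    cis b * rot (t + t') (co z j) (co z i * zeta z).
  by rewrite twist_i twist_j zeta_twist rot_rot' ?sqn_cis.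
have [wk wl] := ample_gt0 ample_twist.
(* Modulus factors telescope: the second twist divides by the squared modulus that the first one has
   produced. *)
have sq (x y d : R) : 0 < y -> 0 < d ->
    Num.sqrt (x / y) * Num.sqrt (y / d) = Num.sqrt (x / d).
  move=> y0 d0; rewrite mulrC -sqrtrM ?divr_ge0 ?ltW//; congr Num.sqrt.
  by field; rewrite !gt_eqF.
apply: coP => m.
rewrite {1}/twist of_coK zi zj !sqnM !sqn_cis !mul1r [RHS]of_coK.
case: ifPn => [_|mi]; first by rewrite cisD; ring.
case: ifPn => [_|mj]; first by rewrite cisD; ring.
case: ifPn => [_|mk].
  rewrite {1}cnorm2_twist_k addrK twist_k -cnorm2_twist_i -cnorm2_twist_k.
  by rewrite -[in RHS](sq _ _ _ wk k0) realCM (opprD a) cisD; ring.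
case: ifPn => [_|ml].
  rewrite {1}cnorm2_twist_l addrK twist_l -cnorm2_twist_j -cnorm2_twist_l.
  by rewrite -[in RHS](sq _ _ _ wl l0) realCM (opprD b) cisD; ring.
by rewrite twist_other.
Qed.

End Ample.
End Flow.

(** * The cutoff Hamiltonian and its flow on CP^n *)

Section HamiltonianFlow.
Context {R : realType} {n : nat} (i j k l : 'I_n.+1).
Hypothesis ijkl : uniq [:: i; j; k; l].
Variables (c eps : R).
Hypothesis eps0 : 0 < eps.
Implicit Types (z w v : cvec R n) (m : 'I_n.+1) (x : R[i]) (q : CP R n).

Definition gapA z : R := (cnorm2 z k - cnorm2 z i) / nsq z.
Definition gapB z : R := (cnorm2 z l - cnorm2 z j) / nsq z.
Definition coupling z : R :=
  complex.Re (co z i * (co z j)^* * zeta k l z) / nsq z.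

(* [gapA] and [gapB] are constant along the flow, hence so is the cutoff; its
   derivatives only contribute the torus rotations of rates [rateA], [rateB]. *)
Definition ham z : R :=
  c * flat 0 (gapA z - eps) * flat 0 (gapB z - eps) * coupling z.

(** [rateA] and [rateB] are the partial derivatives of [ham] in the two gaps, [flat 2] being the
    derivative of [flat 0]. The 1/2 in [rate] offsets the factor 2 of [fs_metric]. *)
Definition rate z : R :=
  c * flat 0 (gapA z - eps) * flat 0 (gapB z - eps) / 2.
Definition rateA z : R :=
  c * flat 2 (gapA z - eps) * flat 0 (gapB z - eps) * coupling z.
Definition rateB z : R :=
  c * flat 0 (gapA z - eps) * flat 2 (gapB z - eps) * coupling z.

Definition flow (t : R) z : cvec R n :=
  twist i j k l (t * rate z) (t * rateA z) (t * rateB z) z.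

Lemma rate_eq0 z : ~~ ((eps < gapA z) && (eps < gapB z)) ->
  [/\ rate z = 0, rateA z = 0, rateB z = 0 & ham z = 0].
Proof.
rewrite negb_and -!leNgt -[gapA z <= _]subr_le0 -[gapB z <= _]subr_le0 /rate /rateA /rateB /ham.
move: (gapA z - eps) (gapB z - eps) (coupling z) => A B C.
by case/orP => h; split; rewrite !(flat_le0 _ h) ?(mulr0, mul0r).
Qed.

Lemma gap_ample z : (0 < gapA z) && (0 < gapB z) -> ample i j k l z.
Proof.
rewrite /gapA /gapB => /andP[hA hB].
(* [nsq z = 0] would give [gapA z = 0], by the convention on division by 0. *)
have z0 : 0 < nsq z.
  rewrite lt_neqAle sumr_ge0 ?andbT => [|m _]; last exact: cnorm2_ge0.
  by apply/eqP => z0; move: hA; rewrite -z0 invr0 mulr0 ltxx.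
move: hA hB; rewrite !pmulr_lgt0 ?invr_gt0// !subr_gt0; by split.
Qed.

Lemma flow_id t z : ~~ ((eps < gapA z) && (eps < gapB z)) -> flow t z = z.
Proof. by rewrite /flow => /rate_eq0[-> -> -> _]; rewrite !mulr0 twist0. Qed.

Lemma gap_eps_ample z : (eps < gapA z) && (eps < gapB z) -> ample i j k l z.
Proof.
by move=> /andP[hA hB]; apply: gap_ample; rewrite !(lt_trans eps0).
Qed.

(* This is why [flow] is a one-parameter group. *)
Lemma gap_twist t a b z : ample i j k l z ->
  [/\ gapA (twist i j k l t a b z) = gapA z,
      gapB (twist i j k l t a b z) = gapB z &
      coupling (twist i j k l t a b z) = coupling z].
Proof.
move=> az; rewrite /gapA /gapB /coupling nsq_twist// cnorm2_twist_k// cnorm2_twist_l//.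
rewrite !addrK; split => //; congr (_ / _).
have [k0 l0] := ample_gt0 az.
rewrite zeta_twist// twist_i// twist_j//.
have u1 := sqn_zeta k0 l0.
rewrite -[RHS](Re_rot t _ _ u1); congr complex.Re.
rewrite conjCM; set p := rot _ _ _; set q := (rot _ _ _)^*.
transitivity (p * q * zeta k l z * (cis a * (cis a)^*) * (cis b * (cis b)^*)).
  by ring.
by rewrite !mulCconj !sqn_cis !mulr1.
Qed.

Lemma rates_flow t z : [/\ rate (flow t z) = rate z,
  rateA (flow t z) = rateA z & rateB (flow t z) = rateB z].
Proof.
have [h|h] := boolP ((eps < gapA z) && (eps < gapB z)); last by rewrite flow_id.
rewrite /rate /rateA /rateB /flow.
by have [-> -> ->] := gap_twist (t * rate z) (t * rateA z) (t * rateB z)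
  (gap_eps_ample h).
Qed.

Lemma flow_add s t z : flow s (flow t z) = flow (s + t) z.
Proof.
have [h|h] := boolP ((eps < gapA z) && (eps < gapB z)); last by rewrite !flow_id.
rewrite {1}/flow; have [-> -> ->] := rates_flow t z.
rewrite /flow twist_add; [|exact: ijkl|exact: gap_eps_ample].
by rewrite -!mulrDl addrC.
Qed.

Lemma flow0 z : flow 0 z = z.
Proof. by rewrite /flow !mul0r twist0. Qed.

Lemma nsq_flow t z : nsq (flow t z) = nsq z.
Proof.
have [h|h] := boolP ((eps < gapA z) && (eps < gapB z)); last by rewrite flow_id.
by rewrite nsq_twist//; exact: gap_eps_ample.
Qed.

Lemma flow_neq0 t z : z != 0 -> flow t z != 0.
Proof. by rewrite -!nsq_gt0 nsq_flow. Qed.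

Lemma gap_cscale x z : x != 0 ->
  [/\ gapA (cscale x z) = gapA z, gapB (cscale x z) = gapB z &
      coupling (cscale x z) = coupling z].
Proof.
move=> x0; have := x0; rewrite -sqn_gt0 => /gt_eqF/negbT s0.
have E a b : sqn x * a / (sqn x * b) = a / b by rewrite -mulf_div divff// mul1r.
rewrite /gapA /gapB /coupling !nsq_cscale !cnorm2_cscale -!mulrBr !E; split => //.
rewrite zeta_cscale// !co_cscale conjCM.
rewrite (_ : _ * _ * _ = (x * x^*) * (co z i * (co z j)^* * zeta k l z)); last by ring.
by rewrite mulCconj ReM/= mul0r subr0 E.
Qed.

Lemma ham_cscale x z : x != 0 -> ham (cscale x z) = ham z.
Proof. by move=> /(gap_cscale z)[gA gB gC]; rewrite /ham gA gB gC. Qed.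

Lemma flow_cscale t x z : x != 0 -> flow t (cscale x z) = cscale x (flow t z).
Proof.
move=> x0; have [gA gB gC] := gap_cscale z x0.
by rewrite /flow /rate /rateA /rateB gA gB gC twist_cscale.
Qed.

Definition rep q : cvec R n := val (repr q).

Lemma rep_neq0 q : rep q != 0.
Proof. exact: valP (repr q). Qed.

Lemma pt_rep q : pt (rep q) = q.
Proof. exact: pt_repr. Qed.

Lemma rep_pt z : z != 0 -> exists2 x, x != 0 & z = cscale x (rep (pt z)).
Proof.
move=> z0; have [|x zE] := (pt_eqP (rep_neq0 (pt z)) z0).1; first exact: pt_rep.
exists x => //; apply/eqP => x0.
by move: z0; rewrite zE x0 cscale0 eqxx.
Qed.

Definition hamCP (t : R) q : R := ham (rep q).

Lemma hamCP_pt t z : z != 0 -> hamCP t (pt z) = ham z.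
Proof. by move=> /rep_pt[x x0 zE]; rewrite [in RHS]zE ham_cscale. Qed.

Definition flowCP t q : CP R n := pt (flow t (rep q)).

Lemma flowCP_pt t z : z != 0 -> flowCP t (pt z) = pt (flow t z).
Proof.
move=> z0; have [x x0 zE] := rep_pt z0; rewrite [in RHS]zE flow_cscale//.
have f0 := flow_neq0 t (rep_neq0 (pt z)).
apply/pt_eqP => //; last by exists x.
by rewrite -flow_cscale// -zE flow_neq0.
Qed.

Lemma flowCP_add s t q : flowCP s (flowCP t q) = flowCP (s + t) q.
Proof. by rewrite {2}/flowCP flowCP_pt ?flow_add// flow_neq0// rep_neq0. Qed.

Lemma flowCP0 q : flowCP 0 q = q.
Proof. by rewrite /flowCP flow0 pt_rep. Qed.

(** When the cosine vanishes, [rot] returns its second argument up to a unit factor, so |z_i| and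
    |z_j| are exchanged; the conserved differences then fix |z_k| and |z_l|. *)
Lemma cnorm2_flow_swap t z : (eps < gapA z) && (eps < gapB z) ->
    cos (t * rate z) = 0 ->
  let d := cnorm2 z j - cnorm2 z i in
  let w := flow t z in
  [/\ cnorm2 w i = cnorm2 z j, cnorm2 w j = cnorm2 z i,
      cnorm2 w k = cnorm2 z k + d & cnorm2 w l = cnorm2 z l - d].
Proof.
move=> /gap_eps_ample az c0 d w.
have [k0 l0] := ample_gt0 az.
have u1 := sqn_zeta k0 l0.
have s1 : sin (t * rate z) ^+ 2 = 1 by rewrite sin2cos2 c0 expr0n subr0.
have R0 (a b : R[i]) : sqn (rot (t * rate z) a b) = sqn b.
  rewrite -[RHS]mul1r -s1 /rot c0 /sqn !complexE/=; ring.
have wi : cnorm2 w i = cnorm2 z j.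
  by rewrite cnorm2_twist_i// R0 sqnM sqnC u1 mulr1.
have wj : cnorm2 w j = cnorm2 z i.
  by rewrite cnorm2_twist_j// R0 sqnM u1 mulr1.
split=> //.
  by rewrite cnorm2_twist_k// wi /d; ring.
by rewrite cnorm2_twist_l// wj /d; ring.
Qed.

End HamiltonianFlow.

(** * Hamilton's equations *)

Section FlowVelocity.
Context {R : realType} {n : nat} (i j k l : 'I_n.+1).
Hypothesis ijkl : uniq [:: i; j; k; l].
Variables (c eps : R).
Hypothesis eps0 : 0 < eps.
Implicit Types (z w v : cvec R n) (m : 'I_n.+1) (x y : R[i]).
Local Open Scope complex_scope.

Lemma is_derive_Re_rot a r x y :
  is_derive (0 : R) (1 : R)
    (fun s : R => complex.Re (cis (s * a) * rot (s * r) x y))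
    (complex.Re ('i * (a%:C * x - r%:C * y))).
Proof.
under eq_fun do rewrite ReM ReRot ImRot /cis /=.
is_derive_tac.
by rewrite !mul0r cos0 sin0 !complexE/=; ring.
Qed.

Lemma is_derive_Im_rot a r x y :
  is_derive (0 : R) (1 : R)
    (fun s : R => complex.Im (cis (s * a) * rot (s * r) x y))
    (complex.Im ('i * (a%:C * x - r%:C * y))).
Proof.
under eq_fun do rewrite ImM ReRot ImRot /cis /=.
is_derive_tac.
by rewrite !mul0r cos0 sin0 !complexE/=; ring.
Qed.

Lemma is_derive_modulus (b d r : R) x y : 0 < b -> d + sqn x = b ->
  is_derive (0 : R) (1 : R)
    (fun s : R => Num.sqrt ((d + sqn (rot (s * r) x y)) / b))
    (r * complex.Im (x^* * y) / b).
Proof.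
move=> b0 dE.
have E : (d + sqn (rot (0 * r) x y)) / b = 1.
  by rewrite mul0r rot0 dE divff// gt_eqF.
rewrite /sqn; under eq_fun do rewrite ReRot ImRot !expr2.
notypeclasses refine (is_derive_congr _ _).
  notypeclasses refine (is_derive_sqrt _ _); last by repeat is_derive_step.
  by move: E; rewrite /sqn ReRot ImRot !expr2 => ->.
move: E; rewrite /sqn ReRot ImRot !expr2 => E.
have c0 : cos (0 * r) = 1 by rewrite mul0r cos0.
have s0 : sin (0 * r) = 0 by rewrite mul0r sin0.
rewrite E sqrtr1 c0 s0 !complexE; field.
by rewrite gt_eqF.
Qed.

(** [dp +i* - a] is the logarithmic derivative at 0 of the factor cis (- s a) p(s), because p(0) =
    1. *)
Lemma is_derive_Re_modulus a (p : R -> R) (dp : R) x :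
  p 0 = 1 -> is_derive (0 : R) (1 : R) p dp ->
  is_derive (0 : R) (1 : R)
    (fun s : R => complex.Re (cis (- (s * a)) * (p s)%:C * x))
    (complex.Re ((dp +i* - a) * x)).
Proof.
move=> p1 Dp.
under eq_fun do rewrite !complexE /cis /= !mulr0 subr0 add0r.
is_derive_tac.
by rewrite !mul0r oppr0 cos0 sin0 p1 !complexE/=; ring.
Qed.

Lemma is_derive_Im_modulus a (p : R -> R) (dp : R) x :
  p 0 = 1 -> is_derive (0 : R) (1 : R) p dp ->
  is_derive (0 : R) (1 : R)
    (fun s : R => complex.Im (cis (- (s * a)) * (p s)%:C * x))
    (complex.Im ((dp +i* - a) * x)).
Proof.
move=> p1 Dp.
under eq_fun do rewrite !complexE /cis /= !mulr0 subr0 add0r.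
is_derive_tac.
by rewrite !mul0r oppr0 cos0 sin0 p1 !complexE/=; ring.
Qed.

Local Notation rate := (rate i j k l c eps).
Local Notation rateA := (rateA i j k l c eps).
Local Notation rateB := (rateB i j k l c eps).
Local Notation flow := (flow i j k l c eps).
Local Notation zeta := (zeta k l).

(** The real parts - r h / |z_k|^2 and r h / |z_l|^2 let |z_k|^2 and |z_l|^2 vary exactly as |z_i|^2
    and |z_j|^2 do, at rates - 2 r h and 2 r h. *)
Definition twist_gen (r a b : R) z : cvec R n :=
  let h := complex.Im (co z i * (co z j)^* * zeta z) in
  of_co (fun m =>
    if m == i then 'i * (a%:C * co z i - r%:C * (co z j * (zeta z)^*))
    else if m == j then 'i * (b%:C * co z j - r%:C * (co z i * zeta z))
    else if m == k then (- (r * h / cnorm2 z k) +i* - a) * co z k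
    else if m == l then ((r * h / cnorm2 z l) +i* - b) * co z l
    else 0).

Definition flow_gen z := twist_gen (rate z) (rateA z) (rateB z) z.

Lemma twist_gen0 z : twist_gen 0 0 0 z = 0.
Proof.
apply: coP => m; rewrite of_coK [RHS](_ : _ = 0); last by rewrite /co /= !mxE.
have z0 : 0%:C = 0 :> R[i] by [].
do 2 (case: ifP => _; first by rewrite z0 !mul0r subr0 mulr0).
do 2 (case: ifP => _; first by rewrite !mul0r ?oppr0; exact: mul0r).
by [].
Qed.

Lemma is_derive_twist (r a b : R) z : ample i j k l z ->
  is_derive (0 : R) (1 : R)
    (fun s : R => twist i j k l (s * r) (s * a) (s * b) z) (twist_gen r a b z).
Proof.
move=> az.
have [k0 l0] := ample_gt0 az.
have Dk : is_derive (0 : R) (1 : R) (fun s : R => Num.sqrt ((cnorm2 z k -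
      cnorm2 z i + sqn (rot (s * r) (co z i) (co z j * (zeta z)^*))) / cnorm2 z k))
    (- (r * complex.Im (co z i * (co z j)^* * zeta z) / cnorm2 z k)).
  have := is_derive_modulus r (co z j * (zeta z)^*) k0 (subrK (sqn (co z i)) _).
  move=> /is_derive_congr; apply; rewrite -mulNr -mulrN; congr (_ * _ / _).
  by rewrite mulrC Im_mul_conj.
have Dl : is_derive (0 : R) (1 : R) (fun s : R => Num.sqrt ((cnorm2 z l -
      cnorm2 z j + sqn (rot (s * r) (co z j) (co z i * zeta z))) / cnorm2 z l))
    (r * complex.Im (co z i * (co z j)^* * zeta z) / cnorm2 z l).
  have := is_derive_modulus r (co z i * zeta z) l0 (subrK (sqn (co z j)) _).
  move=> /is_derive_congr; apply; congr (_ * _ / _).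
  by rewrite mulrC mulrAC.
have k1 : Num.sqrt ((cnorm2 z k - cnorm2 z i +
    sqn (rot (0 * r) (co z i) (co z j * (zeta z)^*))) / cnorm2 z k) = 1.
  by rewrite mul0r rot0 -cnorm2E subrK divff ?sqrtr1// gt_eqF.
have l1 : Num.sqrt ((cnorm2 z l - cnorm2 z j +
    sqn (rot (0 * r) (co z j) (co z i * zeta z))) / cnorm2 z l) = 1.
  by rewrite mul0r rot0 -cnorm2E subrK divff ?sqrtr1// gt_eqF.
have re_co (f : 'I_n.+1 -> R[i]) m : (of_co f).1 0 m = complex.Re (f m).
  by rewrite mxE.
have im_co (f : 'I_n.+1 -> R[i]) m : (of_co f).2 0 m = complex.Im (f m).
  by rewrite mxE.
apply: is_derive_cvec => m; rewrite ?re_co ?im_co.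
- under eq_fun do rewrite re_co.
  case: ifP => _; first exact: is_derive_Re_rot.
  case: ifP => _; first exact: is_derive_Re_rot.
  case: ifP => _; first exact: (is_derive_Re_modulus a (co z k) k1 Dk).
  case: ifP => _; first exact: (is_derive_Re_modulus b (co z l) l1 Dl).
  exact: is_derive_cst.
- under eq_fun do rewrite im_co.
  case: ifP => _; first exact: is_derive_Im_rot.
  case: ifP => _; first exact: is_derive_Im_rot.
  case: ifP => _; first exact: (is_derive_Im_modulus a (co z k) k1 Dk).
  case: ifP => _; first exact: (is_derive_Im_modulus b (co z l) l1 Dl).
  exact: is_derive_cst.
Qed.

Lemma is_derive_flow0 z :
  is_derive (0 : R) (1 : R) (fun s : R => flow s z) (flow_gen z).
Proof.
have [h|h] := boolP ((eps < gapA i k z) && (eps < gapB j l z)).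
  by apply: is_derive_twist; exact: (gap_eps_ample eps0).
rewrite /flow_gen; have [-> -> -> _] := rate_eq0 c h; rewrite twist_gen0.
have -> : (fun s => flow s z) = cst z by apply/funext => s; exact: flow_id.
exact: is_derive_cst.
Qed.

(** By the group law [flow s] is [flow (s - t)] after [flow t], which moves the computation to time
    0. *)
Lemma is_derive_flow t z :
  is_derive (t : R) (1 : R) (fun s : R => flow s z) (flow_gen (flow t z)).
Proof.
have D0 := is_derive_flow0 (flow t z).
have -> : (fun s => flow s z) = (fun s => flow s (flow t z)) \o (fun s => s - t).
  by apply/funext => s; rewrite /= (flow_add ijkl c eps0) subrK.
have dF : differentiable (fun s : R => flow s (flow t z)) ((fun s => s - t) t).
  by rewrite subrr; apply/derivable1_diffP; have [] := D0.
have dt : is_derive (t : R) (1 : R) (fun s : R => s - t) 1.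
  by apply: is_derive_eq; rewrite subr0.
have [dt1 dt2] := dt; move/derivable1_diffP in dt1.
apply: DeriveDef.
  by apply/derivable1_diffP; exact: differentiable_comp.
rewrite deriveE; last exact: differentiable_comp.
have := @deriveE R R R (fun s : R => s - t) t 1 dt1; rewrite dt2 => d1.
rewrite diff_comp// [LHS]/= -d1 -deriveE// subrr.
by have [_ ->] := D0.
Qed.

End FlowVelocity.

(** * The differential of the Hamiltonian against the symplectic form *)

Section HamiltonEquation.
Context {R : realType} {n : nat} (i j k l : 'I_n.+1).
Hypothesis ijkl : uniq [:: i; j; k; l].
Variables (c eps : R).
Hypothesis eps0 : 0 < eps.
Implicit Types (z w v : cvec R n) (m : 'I_n.+1) (x y : R[i]).
Local Open Scope complex_scope.

Local Notation rate' := (rate i j k l c eps).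
Local Notation rateA' := (rateA i j k l c eps).
Local Notation rateB' := (rateB i j k l c eps).
Local Notation ham' := (ham i j k l c eps).
Local Notation zetakl := (zeta k l).
Local Notation cpl := (coupling i j k l).

(* Real and imaginary parts of [v_m * z_m^*]. *)
Definition rdot z v m : R := z.1 0 m * v.1 0 m + z.2 0 m * v.2 0 m.
Definition idot z v m : R := z.1 0 m * v.2 0 m - z.2 0 m * v.1 0 m.

Lemma is_derive_cnorm2 m z v : is_derive z v (fun z => cnorm2 z m) (2 * rdot z v m).
Proof.
rewrite /cnorm2; under eq_fun do rewrite !expr2.
by is_derive_tac; rewrite /rdot; ring.
Qed.

Lemma is_derive_nsq z v : is_derive z v (@nsq R n) (2 * cdot z v).
Proof.
have -> : @nsq R n = \sum_m (fun z => cnorm2 z m).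
  by apply/funext => y; rewrite fct_sumE.
have -> : 2 * cdot z v = \sum_m (2 * rdot z v m) by rewrite mulr_sumr.
by apply: is_derive_sum => m; exact: is_derive_cnorm2.
Qed.

Lemma is_derive_gap m m' z v : z != 0 ->
  is_derive z v (fun z => (cnorm2 z m - cnorm2 z m') / nsq z)
    ((2 * (rdot z v m - rdot z v m') -
      (cnorm2 z m - cnorm2 z m') * (2 * cdot z v) / nsq z) / nsq z).
Proof.
rewrite -nsq_gt0 => z0.
have Dm := is_derive_cnorm2 m z v.
have Dm' := is_derive_cnorm2 m' z v.
have DN := is_derive_nsq z v.
have DV := is_derive_inv (lt0r_neq0 z0) DN.
by is_derive_tac; field; rewrite gt_eqF.
Qed.

(** [idot z v m / cnorm2 z m] is the derivative of arg z_m, so [th] is that of the argument of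
    [zeta], and the derivative of [zeta] is 'i th [zeta]. *)
Lemma is_derive_zeta z v : 0 < cnorm2 z k -> 0 < cnorm2 z l ->
  let th := idot z v k / cnorm2 z k - idot z v l / cnorm2 z l in
  is_derive z v (fun z => complex.Re (zetakl z)) (- complex.Im (zetakl z) * th) /\
  is_derive z v (fun z => complex.Im (zetakl z)) (complex.Re (zetakl z) * th).
Proof.
move=> k0 l0 th.
set r := fun z => Num.sqrt (cnorm2 z k * cnorm2 z l).
have r0 : 0 < r z by rewrite sqrtr_gt0 mulr_gt0.
have Dk := is_derive_cnorm2 k z v.
have Dl := is_derive_cnorm2 l z v.
have Dr : is_derive z v r ((2 * r z)^-1 * (2 * rdot z v k * cnorm2 z l +
    cnorm2 z k * (2 * rdot z v l))).
  apply: is_derive_sqrt; first by rewrite mulr_gt0.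
  by repeat is_derive_step.
have DV := is_derive_inv (lt0r_neq0 r0) Dr.
have rr : r z ^+ 2 = cnorm2 z k * cnorm2 z l by rewrite sqr_sqrtr// ltW// mulr_gt0.
(* The logarithmic derivative of 1 / |z_k z_l|: it cancels the radial parts of the variations of z_k
   and z_l and leaves the angular ones. *)
have dV : - (r z)^-2 * ((2 * r z)^-1 * (2 * rdot z v k * cnorm2 z l +
    cnorm2 z k * (2 * rdot z v l))) =
   - (rdot z v k / cnorm2 z k + rdot z v l / cnorm2 z l) * (r z)^-1.
  by rewrite rr; field; rewrite !gt_eqF.
rewrite dV in DV.
have ReE : (fun z => complex.Re (zetakl z)) =
    (fun z => (z.1 0 k * z.1 0 l + z.2 0 k * z.2 0 l) * (r z)^-1).
  by apply/funext => y; rewrite /zeta !complexE/= /r; ring.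
have ImE : (fun z => complex.Im (zetakl z)) =
    (fun z => (z.2 0 k * z.1 0 l - z.1 0 k * z.2 0 l) * (r z)^-1).
  by apply/funext => y; rewrite /zeta !complexE/= /r; ring.
have /= ReEz := congr1 (fun f => f z) ReE.
have /= ImEz := congr1 (fun f => f z) ImE.
rewrite ReEz ImEz ReE ImE /th.
have k0' := gt_eqF k0; have l0' := gt_eqF l0; have r0' := gt_eqF r0.
split; is_derive_tac; move: k0' l0'; rewrite /rdot /idot /cnorm2 => k0' l0';
  by field; rewrite r0' k0' l0'.
Qed.

Definition dcoupling z v : R :=
  let p := co z i * (co z j)^* * zetakl z in
  complex.Re (co v i * (co z j)^* * zetakl z + co z i * (co v j)^* * zetakl z)
  - complex.Im p * (idot z v k / cnorm2 z k - idot z v l / cnorm2 z l).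

Lemma is_derive_coupling_num z v : 0 < cnorm2 z k -> 0 < cnorm2 z l ->
  is_derive z v (fun z => complex.Re (co z i * (co z j)^* * zetakl z))
    (dcoupling z v).
Proof.
move=> k0 l0; have [DRe DIm] := is_derive_zeta v k0 l0.
rewrite /dcoupling; move: (idot z v k / _ - _) DRe DIm => th DRe DIm.
have -> : (fun z => complex.Re (co z i * (co z j)^* * zetakl z)) = (fun z =>
   (z.1 0 i * z.1 0 j + z.2 0 i * z.2 0 j) * complex.Re (zetakl z) -
   (z.2 0 i * z.1 0 j - z.1 0 i * z.2 0 j) * complex.Im (zetakl z)).
  by apply/funext => y; rewrite !complexE /co /=; ring.
is_derive_tac.
move: (zetakl z) => s; rewrite !complexE /co /=.
move: (z.1 0 i) (z.2 0 i) (z.1 0 j) (z.2 0 j) => zi1 zi2 zj1 zj2.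
move: (v.1 0 i) (v.2 0 i) (v.1 0 j) (v.2 0 j) => vi1 vi2 vj1 vj2.
by move: (complex.Re s) (complex.Im s) => s1 s2; ring.
Qed.

Lemma is_derive_flat_gap (g : cvec R n -> R) z v (d : R) :
  is_derive z v g d -> is_derive z v (fun z => flat 0 (g z - eps))
    (flat 2 (g z - eps) * d).
Proof.
move=> Dg; have Df := is_derive_flat 0 (g z - eps).
have Dg' : is_derive z v (fun z => g z - eps) d.
  by is_derive_tac; rewrite addr0.
by apply: is_derive_congr (is_derive_comp1 Dg' Df) _; rewrite mul0r subr0.
Qed.

Definition dgap m m' z v : R :=
  (2 * (rdot z v m - rdot z v m') -
      (cnorm2 z m - cnorm2 z m') * (2 * cdot z v) / nsq z) / nsq z.

(** Grouped by rates so as to coincide term by term with [fs_form_twist_gen]. *)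
Lemma is_derive_ham z v : ample i j k l z -> z != 0 ->
  is_derive z v ham' (rateA' z * dgap k i z v + rateB' z * dgap l j z v +
    2 * rate' z * ((dcoupling z v - cpl z * (2 * cdot z v)) / nsq z)).
Proof.
move=> az z0; have := z0; rewrite -nsq_gt0 => N0.
have [k0 l0] := ample_gt0 az.
have DA := is_derive_flat_gap (is_derive_gap k i v z0).
have DB := is_derive_flat_gap (is_derive_gap l j v z0).
have DM := is_derive_coupling_num v k0 l0.
have DN := is_derive_inv (lt0r_neq0 N0) (is_derive_nsq z v).
rewrite -/(gapA i k _) -/(gapB j l _) in DA DB.
rewrite (_ : ham' = fun z => c * flat 0 (gapA i k z - eps) * flat 0 (gapB j l z - eps) *
  (complex.Re (co z i * (co z j)^* * zetakl z) * (nsq z)^-1)); last by [].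
is_derive_tac.
rewrite /rateA /rateB /rate -/(dgap k i z v) -/(dgap l j z v).
rewrite /coupling; field.
by rewrite gt_eqF.
Qed.

Lemma Re_mul_rot_gen a r x y u :
  complex.Re ('i * ('i * (a%:C * x - r%:C * y)) * u^*) =
  - a * complex.Re (x * u^*) + r * complex.Re (y * u^*).
Proof. by rewrite !complexE /=; ring. Qed.

Lemma Re_mul_modulus_gen (p a : R) x u :
  complex.Re ('i * ((p +i* - a) * x) * u^*) =
  a * complex.Re (x * u^*) - p * complex.Im (x * u^*).
Proof. by rewrite !complexE /=; ring. Qed.

Lemma Re_mul_co z v m : complex.Re (co z m * (co v m)^*) = rdot z v m.
Proof. by rewrite !complexE /rdot /=; ring. Qed.

Lemma Im_mul_co z v m : complex.Im (co z m * (co v m)^*) = - idot z v m.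
Proof. by rewrite !complexE /idot /=; ring. Qed.

(** The parts of the generator along [a], [b], [r] are dual to the two gaps and to twice the
    coupling; [T1], [T2], [T3] are the three pairings that occur in [fs_metric]. *)
Lemma fs_form_twist_gen r a b z v : ample i j k l z -> z != 0 ->
  fs_form z (twist_gen i j k l r a b z) v =
  a * dgap k i z v + b * dgap l j z v +
  2 * r * ((dcoupling z v - cpl z * (2 * cdot z v)) / nsq z).
Proof.
move=> az z0; have := z0; rewrite -nsq_gt0 => N0.
have [k0 l0] := ample_gt0 az.
set w := twist_gen _ _ _ _ _ _ _ _.
have [[/negbTE ji /negbTE ki /negbTE li] [/negbTE kj /negbTE lj /negbTE lk]] :=
  uniq4_neq ijkl.
set h := complex.Im (co z i * (co z j)^* * zetakl z).
have wi : co w i = 'i * (a%:C * co z i - r%:C * (co z j * (zetakl z)^*)).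
  by rewrite of_coK eqxx.
have wj : co w j = 'i * (b%:C * co z j - r%:C * (co z i * zetakl z)).
  by rewrite of_coK ji eqxx.
have wk : co w k = (- (r * h / cnorm2 z k) +i* - a) * co z k.
  by rewrite of_coK ki kj eqxx.
have wl : co w l = ((r * h / cnorm2 z l) +i* - b) * co z l.
  by rewrite of_coK li lj lk eqxx.
have wo m : [&& m != i, m != j, m != k & m != l] -> co w m = 0.
  by case/and4P => /negbTE mi /negbTE mj /negbTE mk /negbTE ml;
     rewrite of_coK mi mj mk ml.
have cdotE u : cdot (cscale 'i w) u = complex.Re ('i * co w i * (co u i)^*) +
    complex.Re ('i * co w j * (co u j)^*) + complex.Re ('i * co w k * (co u k)^*) +
    complex.Re ('i * co w l * (co u l)^*).
  have coE m : (cscale 'i w).1 0 m * u.1 0 m + (cscale 'i w).2 0 m * u.2 0 m =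
     complex.Re ('i * co w m * (co u m)^*).
    by rewrite !complexE /co /= !mxE; ring.
  rewrite /cdot; under eq_bigr do rewrite coE.
  rewrite (sum_four ijkl) [X in _ + X]big1 ?addr0// => m /wo ->.
  by rewrite mulr0 mul0r.
have wE u : cdot (cscale 'i w) u =
    a * (complex.Re (co z k * (co u k)^*) - complex.Re (co z i * (co u i)^*)) +
    b * (complex.Re (co z l * (co u l)^*) - complex.Re (co z j * (co u j)^*)) +
    r * (complex.Re (co z j * (zetakl z)^* * (co u i)^*) +
         complex.Re (co z i * zetakl z * (co u j)^*) +
         h * (complex.Im (co z k * (co u k)^*) / cnorm2 z k -
              complex.Im (co z l * (co u l)^*) / cnorm2 z l)).
  rewrite cdotE wi wj wk wl !Re_mul_rot_gen !Re_mul_modulus_gen.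
  by ring.
have T1 : cdot (cscale 'i w) v = a * (rdot z v k - rdot z v i) +
    b * (rdot z v l - rdot z v j) + r * dcoupling z v.
  rewrite wE !Re_mul_co !Im_mul_co /dcoupling -/h; congr (_ + _ * _).
  by rewrite Re_mul_conj [co z i * _ * _]mulrAC ReD; ring.
have rdotE m : rdot z z m = cnorm2 z m by rewrite /rdot /cnorm2 !expr2.
have idotE m : idot z z m = 0 by rewrite /idot mulrC subrr.
(* This pairing yields the terms in [cdot z v], which on the other side come from differentiating 1
   / [nsq]. *)
have T2 : cdot (cscale 'i w) z = a * (cnorm2 z k - cnorm2 z i) +
    b * (cnorm2 z l - cnorm2 z j) +
    2 * r * complex.Re (co z i * (co z j)^* * zetakl z).
  rewrite wE !Re_mul_co !Im_mul_co !rdotE !idotE oppr0 !mul0r subrr mulr0 addr0.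
  by congr (_ + _); rewrite Re_mul_conj [co z i * zetakl z * _]mulrAC; ring.
(* Twice this number is the derivative of |z|^2 along [w]: the variations of |z_i|^2 and |z_k|^2
   balance those of |z_j|^2 and |z_l|^2. *)
have T3 : cdot (cscale 'i w) (cscale 'i z) = 0.
  rewrite wE !co_cscale.
  have Rei x y : complex.Re (x * ('i * y)^*) = complex.Im (x * y^*).
    by rewrite !complexE /=; ring.
  have Imi x y : complex.Im (x * ('i * y)^*) = - complex.Re (x * y^*).
    by rewrite !complexE /=; ring.
  rewrite !Rei !Imi !Re_mul_co !Im_mul_co !rdotE !idotE !mulNr !divff ?gt_eqF//.
  by rewrite Im_mul_conj [co z i * zetakl z * _]mulrAC -/h; ring.
have zz : cdot z z = nsq z.
  by rewrite /cdot /nsq; apply: eq_bigr => m _; rewrite /cnorm2 !expr2.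
rewrite /fs_form /fs_metric T1 T2 T3 mul0r subr0 zz /dgap /coupling.
by field; rewrite gt_eqF.
Qed.

End HamiltonEquation.

(** * Smoothness of the flow and of the Hamiltonian *)

Section FlowSmoothness.
Context {R : realType} {n : nat} (i j k l : 'I_n.+1).
Hypothesis ijkl : uniq [:: i; j; k; l].
Variables (c eps : R).
Hypothesis eps0 : 0 < eps.
Implicit Types (z w v : cvec R n) (m : 'I_n.+1) (x y : R[i]).

Local Notation rate' := (rate i j k l c eps).
Local Notation rateA' := (rateA i j k l c eps).
Local Notation rateB' := (rateB i j k l c eps).
Local Notation flow' := (flow i j k l c eps).
Local Notation ham' := (ham i j k l c eps).

Ltac iter_diff_step := first
  [ assumption
  | exact: iter_diff_on_cst
  | exact: iter_diff_on_re
  | exact: iter_diff_on_im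
  | refine (iter_diff_on_comp (O := setT) _ (iter_diff_on_sincos _).1 _); first by []
  | refine (iter_diff_on_comp (O := setT) _ (iter_diff_on_sincos _).2 _); first by []
  | refine (iter_diff_onM _ _)
  | refine (iter_diff_onN _)
  | refine (iter_diff_onB _ _)
  | refine (iter_diff_onD _ _) ].

Lemma open_neq0 : open [set z : cvec R n | z != 0].
Proof.
have -> : [set z : cvec R n | z != 0] = ~` [set (0 : cvec R n)].
  by apply/seteqP; split => z /=; [move/eqP|move=> ?; apply/eqP].
by rewrite openC; exact/accessible_closed_set1/hausdorff_accessible/norm_hausdorff.
Qed.

Lemma iter_diff_on_cnorm2 p U m : iter_diff_on p U (fun z => cnorm2 z m).
Proof.
rewrite (_ : (fun z => _) = fun z => z.1 0 m * z.1 0 m + z.2 0 m * z.2 0 m); last first.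
  by apply/funext => z; rewrite /cnorm2 !expr2.
by repeat iter_diff_step.
Qed.

Lemma iter_diff_on_nsq p U : iter_diff_on p U (@nsq R n).
Proof. by apply: iter_diff_on_sum => m _; exact: iter_diff_on_cnorm2. Qed.

Lemma iter_diff_on_nsqV p (U : set (cvec R n)) : U `<=` [set z | z != 0] ->
  iter_diff_on p U (fun z => (nsq z)^-1).
Proof.
move=> U0; apply: (iter_diff_on_comp _ (iter_diff_on_inv p)); last exact: iter_diff_on_nsq.
by move=> z /U0 /=; rewrite nsq_eq0.
Qed.

Lemma iter_diff_on_gap p (U : set (cvec R n)) m m' : U `<=` [set z | z != 0] ->
  iter_diff_on p U (fun z => (cnorm2 z m - cnorm2 z m') / nsq z).
Proof.
move=> U0; have := iter_diff_on_nsqV p U0.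
have := iter_diff_on_cnorm2 p U m; have := iter_diff_on_cnorm2 p U m'.
by move=> *; repeat iter_diff_step.
Qed.

Lemma continuous_gap m m' z : z != 0 ->
  {for z, continuous (fun z => (cnorm2 z m - cnorm2 z m') / nsq z)}.
Proof.
move=> z0; apply: differentiable_continuous.
by have [+ _] := @iter_diff_on_gap 0%N [set z | z != 0] m m' (fun _ => id); exact.
Qed.

(** With [still], an open cover of the nonzero vectors; the threshold eps / 2 makes the two sets
    overlap. On [moving] z_k and z_l do not vanish, so the formulas are smooth; on [still] the
    cutoff vanishes and nothing moves. *)
Definition moving : set (cvec R n) :=
  [set z | [/\ z != 0, eps / 2 < gapA i k z & eps / 2 < gapB j l z]].

Definition still : set (cvec R n) :=
  [set z | z != 0 /\ (gapA i k z < eps \/ gapB j l z < eps)].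

Lemma open_moving : open moving.
Proof.
rewrite openE => z [z0 hA hB]; rewrite /interior.
have := open_nbhs_nbhs (conj open_neq0 z0).
have := continuous_gap (m := k) (m' := i) z0 => /cvgr_gt /(_ _ hA).
have := continuous_gap (m := l) (m' := j) z0 => /cvgr_gt /(_ _ hB).
by apply: filterS3 => w; split.
Qed.

Lemma open_still : open still.
Proof.
rewrite openE => z [z0 [hA|hB]]; rewrite /interior.
- have := open_nbhs_nbhs (conj open_neq0 z0).
  have := continuous_gap (m := k) (m' := i) z0 => /cvgr_lt /(_ _ hA).
  by apply: filterS2 => w h ?; split => //; left.
- have := open_nbhs_nbhs (conj open_neq0 z0).
  have := continuous_gap (m := l) (m' := j) z0 => /cvgr_lt /(_ _ hB).
  by apply: filterS2 => w h ?; split => //; right.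
Qed.

Lemma moving_or_still z : z != 0 -> moving z \/ still z.
Proof.
have e2 : eps / 2 < eps by rewrite gtr_pMr// invf_lt1// ltr1n.
move=> z0; have [hA|hA] := ltP (gapA i k z) eps; first by right; split => //; left.
have [hB|hB] := ltP (gapB j l z) eps; first by right; split => //; right.
by left; split => //; exact: lt_le_trans e2 _.
Qed.

Lemma still_stays z : still z ->
  [/\ rate' z = 0, rateA' z = 0, rateB' z = 0 & ham' z = 0].
Proof.
move=> [_ h]; apply: rate_eq0; rewrite negb_and -!leNgt.
by case: h => /ltW ->; rewrite ?orbT.
Qed.

Lemma moving_ample z : moving z -> ample i j k l z.
Proof.
move=> [_ hA hB]; have e2 : 0 < eps / 2 by rewrite divr_gt0.
by apply: gap_ample; rewrite !(lt_trans e2).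
Qed.

Lemma moving_gt0 z : moving z -> 0 < cnorm2 z k /\ 0 < cnorm2 z l.
Proof. by move=> /moving_ample/ample_gt0. Qed.

Lemma iter_diff_on_zeta p :
  iter_diff_on p moving (fun z => complex.Re (zeta k l z)) /\
  iter_diff_on p moving (fun z => complex.Im (zeta k l z)).
Proof.
have Dk := iter_diff_on_cnorm2 p moving k.
have Dl := iter_diff_on_cnorm2 p moving l.
have Dr : iter_diff_on p moving (fun z => (Num.sqrt (cnorm2 z k * cnorm2 z l))^-1).
  apply: (iter_diff_on_comp _ (iter_diff_on_inv p)) => [z /moving_gt0[k0 l0] /=|].
    by rewrite gt_eqF// sqrtr_gt0 mulr_gt0.
  apply: (iter_diff_on_comp _ (iter_diff_on_sqrt p)) => [z /moving_gt0[k0 l0] /=|].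
    by rewrite mulr_gt0.
  by repeat iter_diff_step.
split.
- rewrite (_ : (fun z => _) = fun z => (z.1 0 k * z.1 0 l + z.2 0 k * z.2 0 l) *
    (Num.sqrt (cnorm2 z k * cnorm2 z l))^-1); first by repeat iter_diff_step.
  by apply/funext => z; rewrite /zeta !complexE/=; ring.
- rewrite (_ : (fun z => _) = fun z => (z.2 0 k * z.1 0 l - z.1 0 k * z.2 0 l) *
    (Num.sqrt (cnorm2 z k * cnorm2 z l))^-1); first by repeat iter_diff_step.
  by apply/funext => z; rewrite /zeta !complexE/=; ring.
Qed.

Lemma moving_neq0 : moving `<=` [set z | z != 0].
Proof. by move=> z []. Qed.

Lemma iter_diff_on_coupling p : iter_diff_on p moving (coupling i j k l).
Proof.
have [D1 D2] := iter_diff_on_zeta p.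
have DN := iter_diff_on_nsqV p moving_neq0.
rewrite (_ : coupling i j k l = fun z =>
   ((z.1 0 i * z.1 0 j + z.2 0 i * z.2 0 j) * complex.Re (zeta k l z) -
   (z.2 0 i * z.1 0 j - z.1 0 i * z.2 0 j) * complex.Im (zeta k l z)) *
   (nsq z)^-1); first by repeat iter_diff_step.
apply/funext => z; rewrite /coupling; congr (_ * _).
by rewrite !complexE /=; ring.
Qed.

Lemma iter_diff_on_flat_gap p r m m' : iter_diff_on p moving
  (fun z => flat r ((cnorm2 z m - cnorm2 z m') / nsq z - eps)).
Proof.
apply: (iter_diff_on_comp (O := setT) _ (iter_diff_on_flat p r)) => //.
apply: iter_diff_onB; first exact: (iter_diff_on_gap p m m' moving_neq0).
exact: iter_diff_on_cst.
Qed.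

Lemma iter_diff_on_rates p : [/\ iter_diff_on p moving rate',
  iter_diff_on p moving rateA', iter_diff_on p moving rateB' &
  iter_diff_on p moving ham'].
Proof.
have DG := iter_diff_on_coupling p.
have DA0 := iter_diff_on_flat_gap p 0 k i.
have DA2 := iter_diff_on_flat_gap p 2 k i.
have DB0 := iter_diff_on_flat_gap p 0 l j.
have DB2 := iter_diff_on_flat_gap p 2 l j.
by split; rewrite /rate /rateA /rateB /ham /gapA /gapB; repeat iter_diff_step.
Qed.

Lemma iter_diff_on_rot p (t : R) (m : 'I_n.+1) (Y : cvec R n -> R[i]) :
  iter_diff_on p moving (fun z => complex.Re (Y z)) ->
  iter_diff_on p moving (fun z => complex.Im (Y z)) ->
  iter_diff_on p moving (fun z => complex.Re (rot (t * rate' z) (co z m) (Y z))) /\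
  iter_diff_on p moving (fun z => complex.Im (rot (t * rate' z) (co z m) (Y z))).
Proof.
move=> Y1 Y2; have [Dr _ _ _] := iter_diff_on_rates p.
split.
- rewrite (_ : (fun z => _) = fun z => cos (t * rate' z) * z.1 0 m +
    sin (t * rate' z) * complex.Im (Y z)); first by repeat iter_diff_step.
  by apply/funext => z; rewrite ReRot.
- rewrite (_ : (fun z => _) = fun z => cos (t * rate' z) * z.2 0 m -
    sin (t * rate' z) * complex.Re (Y z)); first by repeat iter_diff_step.
  by apply/funext => z; rewrite ImRot.
Qed.

Lemma iter_diff_on_cisM p (g : cvec R n -> R) (Y : cvec R n -> R[i]) :
  iter_diff_on p moving g ->
  iter_diff_on p moving (fun z => complex.Re (Y z)) ->
  iter_diff_on p moving (fun z => complex.Im (Y z)) ->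
  iter_diff_on p moving (fun z => complex.Re (cis (g z) * Y z)) /\
  iter_diff_on p moving (fun z => complex.Im (cis (g z) * Y z)).
Proof.
move=> Dg Y1 Y2; split.
- rewrite (_ : (fun z => _) = fun z => cos (g z) * complex.Re (Y z) -
    sin (g z) * complex.Im (Y z)); first by repeat iter_diff_step.
  by apply/funext => z; rewrite ReM.
- rewrite (_ : (fun z => _) = fun z => cos (g z) * complex.Im (Y z) +
    sin (g z) * complex.Re (Y z)); first by repeat iter_diff_step.
  by apply/funext => z; rewrite ImM.
Qed.

(** The strict inequality keeps the radicand positive, away from the singularity of the square
    root. *)
Lemma iter_diff_on_modulus p m m' (Y : cvec R n -> R[i]) :
  (forall z, moving z -> cnorm2 z m' < cnorm2 z m) ->
  iter_diff_on p moving (fun z => complex.Re (Y z)) ->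
  iter_diff_on p moving (fun z => complex.Im (Y z)) ->
  iter_diff_on p moving (fun z =>
    Num.sqrt ((cnorm2 z m - cnorm2 z m' + sqn (Y z)) / cnorm2 z m)).
Proof.
move=> lt_m Y1 Y2.
have Dm := iter_diff_on_cnorm2 p moving m.
have Dm' := iter_diff_on_cnorm2 p moving m'.
have m0 z : moving z -> 0 < cnorm2 z m.
  by move=> /lt_m; apply: le_lt_trans; exact: cnorm2_ge0.
have DV : iter_diff_on p moving (fun z => (cnorm2 z m)^-1).
  apply: (iter_diff_on_comp _ (iter_diff_on_inv p)) => [z /m0 /= ?|//].
  by rewrite gt_eqF.
apply: (iter_diff_on_comp _ (iter_diff_on_sqrt p)) => [z Mz /=|].
  by rewrite divr_gt0 ?m0// ltr_wpDr ?sqn_ge0// subr_gt0 lt_m.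
rewrite (_ : (fun z => _) = fun z => (cnorm2 z m - cnorm2 z m' +
  (complex.Re (Y z) * complex.Re (Y z) + complex.Im (Y z) * complex.Im (Y z))) *
  (cnorm2 z m)^-1); first by repeat iter_diff_step.
by apply/funext => z; rewrite /sqn !expr2.
Qed.

Lemma iter_diff_on_flow p t : iter_diff_on p moving (flow' t).
Proof.
have [Dr DA DB _] := iter_diff_on_rates p.
have [D1 D2] := iter_diff_on_zeta p.
have [I1 I2] : iter_diff_on p moving
      (fun z => complex.Re (rot (t * rate' z) (co z i) (co z j * (zeta k l z)^*))) /\
    iter_diff_on p moving
      (fun z => complex.Im (rot (t * rate' z) (co z i) (co z j * (zeta k l z)^*))).
  apply: iter_diff_on_rot.
  - rewrite (_ : (fun z => _) = fun z => z.1 0 j * complex.Re (zeta k l z) +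
      z.2 0 j * complex.Im (zeta k l z)); first by repeat iter_diff_step.
    by apply/funext => z; rewrite !complexE /=; ring.
  - rewrite (_ : (fun z => _) = fun z => z.2 0 j * complex.Re (zeta k l z) -
      z.1 0 j * complex.Im (zeta k l z)); first by repeat iter_diff_step.
    by apply/funext => z; rewrite !complexE /=; ring.
have [J1 J2] : iter_diff_on p moving
      (fun z => complex.Re (rot (t * rate' z) (co z j) (co z i * zeta k l z))) /\
    iter_diff_on p moving
      (fun z => complex.Im (rot (t * rate' z) (co z j) (co z i * zeta k l z))).
  apply: iter_diff_on_rot.
  - rewrite (_ : (fun z => _) = fun z => z.1 0 i * complex.Re (zeta k l z) -
      z.2 0 i * complex.Im (zeta k l z)); first by repeat iter_diff_step.
    by apply/funext => z; rewrite !complexE.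
  - rewrite (_ : (fun z => _) = fun z => z.1 0 i * complex.Im (zeta k l z) +
      z.2 0 i * complex.Re (zeta k l z)); first by repeat iter_diff_step.
    by apply/funext => z; rewrite !complexE.
have DtA : iter_diff_on p moving (fun z => t * rateA' z) by repeat iter_diff_step.
have DtB : iter_diff_on p moving (fun z => t * rateB' z) by repeat iter_diff_step.
have Sk := iter_diff_on_modulus (fun z M => (moving_ample M).1) I1 I2.
have Sl := iter_diff_on_modulus (fun z M => (moving_ample M).2) J1 J2.
have realM (s : cvec R n -> R) m : iter_diff_on p moving s ->
    iter_diff_on p moving (fun z => complex.Re ((s z)%:C%C * co z m)) /\
    iter_diff_on p moving (fun z => complex.Im ((s z)%:C%C * co z m)).
  move=> Ds; split.
  - rewrite (_ : (fun z => _) = fun z => s z * z.1 0 m); first by repeat iter_diff_step.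
    by apply/funext => z; rewrite !complexE /=; ring.
  - rewrite (_ : (fun z => _) = fun z => s z * z.2 0 m); first by repeat iter_diff_step.
    by apply/funext => z; rewrite !complexE /=; ring.
have Ci := iter_diff_on_cisM DtA I1 I2.
have Cj := iter_diff_on_cisM DtB J1 J2.
have Ck := iter_diff_on_cisM (iter_diff_onN DtA) (realM _ k Sk).1 (realM _ k Sk).2.
have Cl := iter_diff_on_cisM (iter_diff_onN DtB) (realM _ l Sl).1 (realM _ l Sl).2.
apply: iter_diff_on_cvec => m.
- rewrite (_ : (fun z => _) = fun z => complex.Re (co (flow' t z) m)); last by [].
  rewrite /flow /twist; under eq_fun do rewrite of_coK -!(mulrA (cis (- _))).
  case: (m == i); first exact: Ci.1.
  case: (m == j); first exact: Cj.1.
  case: (m == k); first exact: Ck.1.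
  case: (m == l); first exact: Cl.1.
  exact: iter_diff_on_re.
- rewrite (_ : (fun z => _) = fun z => complex.Im (co (flow' t z) m)); last by [].
  rewrite /flow /twist; under eq_fun do rewrite of_coK -!(mulrA (cis (- _))).
  case: (m == i); first exact: Ci.2.
  case: (m == j); first exact: Cj.2.
  case: (m == k); first exact: Ck.2.
  case: (m == l); first exact: Cl.2.
  exact: iter_diff_on_im.
Qed.

Lemma smooth_flowCP t : smooth_map (flowCP i j k l c eps t).
Proof.
move=> z /= z0; have [Mz|Sz] := moving_or_still z0.
- exists moving, (flow' t); split=> //; first exact: open_moving.
    by move=> p; apply: iter_diff_on_Ck; [exact: open_moving|exact: iter_diff_on_flow].
  move=> y [y0 _ _]; split; first exact: flow_neq0.
  by rewrite /= flowCP_pt.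
- exists still, id; split=> //; first exact: open_still.
    move=> p; apply: iter_diff_on_Ck; first exact: open_still.
    apply: iter_diff_on_cvec => m; [exact: iter_diff_on_re|exact: iter_diff_on_im].
  move=> y Sy; have y0 := Sy.1; split => //.
  by rewrite /= flowCP_pt// /flow; have [-> -> -> _] := still_stays Sy;
    rewrite !mulr0 twist0.
Qed.

Lemma smooth_hamCP : smooth_hamiltonian (hamCP i j k l c eps).
Proof.
have linear_snd : linear (fun tz : R * cvec R n => tz.2) by [].
have cont_snd : continuous (fun tz : R * cvec R n => tz.2) by move=> tz; exact: cvg_snd.
have open_snd (U : set (cvec R n)) : open U -> open ((fun tz : R * cvec R n => tz.2) @^-1` U).
  by move=> oU; apply: open_comp => // tz _; exact: cont_snd.
move=> p; apply: Ck_on_local => -[s z] /= z0; have [Mz|Sz] := moving_or_still z0.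
- exists ((fun tz : R * cvec R n => tz.2) @^-1` moving); split=> //.
    exact/open_snd/open_moving.
  apply: (@Ck_on_eq _ _ _ _ _ _ (ham' \o snd)); first exact/open_snd/open_moving.
    by move=> [s' z'] [/= z'0 _ _]; rewrite hamCP_pt.
  apply: iter_diff_on_Ck; first exact/open_snd/open_moving.
  by apply: iter_diff_on_lincomp => //; have [] := iter_diff_on_rates p.
- exists ((fun tz : R * cvec R n => tz.2) @^-1` still); split=> //.
    exact/open_snd/open_still.
  apply: (@Ck_on_eq _ _ _ _ _ _ (cst 0)); first exact/open_snd/open_still.
    move=> [s' z'] /= Sz'; rewrite hamCP_pt ?Sz'.1//.
    by have [] := still_stays Sz'.
  apply: iter_diff_on_Ck; first exact/open_snd/open_still.
  exact: iter_diff_on_cst.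
Qed.

End FlowSmoothness.

(** * The flow as a Hamiltonian isotopy of CP^n *)

Section HamiltonianDiffeomorphism.
Context {R : realType} {n : nat} (i j k l : 'I_n.+1).
Hypothesis ijkl : uniq [:: i; j; k; l].
Variables (c eps : R).
Hypothesis eps0 : 0 < eps.

Local Notation ham' := (ham i j k l c eps).
Local Notation hamCP' := (hamCP i j k l c eps).
Local Notation flowCP' := (flowCP i j k l c eps).

Lemma fs_form0 (z v : cvec R n) : fs_form z 0 v = 0.
Proof.
have c0 (u : cvec R n) : cdot 0 u = 0.
  by rewrite /cdot big1// => m _; rewrite !mxE !mul0r addr0.
have i0 : cscale 'i%C (0 : cvec R n) = 0 by rewrite /cscale/= !scaler0 subr0 addr0.
by rewrite /fs_form i0 /fs_metric !c0 !mul0r !subr0 mulr0 mul0r.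
Qed.

Lemma hamilton_equation (z v : cvec R n) : z != 0 ->
  fs_form z (flow_gen i j k l c eps z) v = 'D_v ham' z.
Proof.
move=> z0; have [/andP[ik jl]|] := boolP ((cnorm2 z i < cnorm2 z k) && (cnorm2 z j < cnorm2 z l)).
  have az : ample i j k l z by [].
  by rewrite /flow_gen fs_form_twist_gen//; have [_ ->] := is_derive_ham c eps v az z0.
rewrite negb_and -!leNgt => le_kl.
(* If ampleness fails, one of the gaps is at most 0, hence below [eps]: near [z] the Hamiltonian is
   0, and the generator vanishes at [z]. *)
have Sz : still i j k l eps z.
  split=> //; have N0 : 0 < (nsq z)^-1 by rewrite invr_gt0 nsq_gt0.
  case/orP: le_kl => le; [left|right]; apply: le_lt_trans eps0;
    by rewrite /gapA /gapB pmulr_lle0// subr_le0.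
rewrite /flow_gen; have [-> -> -> _] := still_stays c Sz.
rewrite twist_gen0 fs_form0 -(derive_cst (0 : R) z v).
apply: near_eq_derive.
have := open_nbhs_nbhs (conj (@open_still R n i j k l eps) Sz).
by apply: filterS => y /(still_stays c)[].
Qed.

Lemma hamiltonian_flowCP : hamiltonian_flow hamCP' flowCP'.
Proof.
split=> [q|q t _]; first exact: flowCP0.
set z := flow i j k l c eps t (rep q).
have z0 : z != 0 by rewrite flow_neq0// rep_neq0.
exists z, (flow_gen i j k l c eps z); split.
  exists (fun s => flow i j k l c eps s (rep q)); split=> //.
    by near=> s; rewrite flow_neq0// rep_neq0.
  exact: is_derive_flow.
move=> v; rewrite hamilton_equation//; apply: near_eq_derive.
have := open_nbhs_nbhs (conj open_neq0 z0).
by apply: filterS => y y0; rewrite hamCP_pt.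
Unshelve. all: by end_near. Qed.

Lemma Ham_flowCP : Ham (flowCP' 1).
Proof.
split.
  split; first exact: smooth_flowCP.
  exists (flowCP' (- 1)); split; first exact: smooth_flowCP.
  - by move=> q; rewrite flowCP_add// addNr flowCP0.
  - by move=> q; rewrite flowCP_add// subrr flowCP0.
exists hamCP', flowCP'; split=> //; first exact: smooth_hamCP.
exact: hamiltonian_flowCP.
Qed.

End HamiltonianDiffeomorphism.

(** * The volume of the torus orbits *)

Section Angles.
Context {R : realType}.
Implicit Types (x y : R[i]) (a b : R).

(** If d is the difference of the angles, cis d = 1 forces sin (d / 2) = 0, while |d| / 2 < pi and
    the sine is positive between 0 and pi. *)
Lemma cis_inj : {in `[0, pi *+ 2[ &, injective (@cis R)}.
Proof.
move=> a b; rewrite !in_itv /= => /andP[a0 a2] /andP[b0 b2] ab.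
apply/eqP; rewrite -subr_eq0; apply/eqP; set d := a - b.
have /(congr1 (@complex.Re R)) /= cd1 : cis d = 1.
  by rewrite /d cisD ab -cisC mulCconj sqn_cis.
have sd0 : sin (d / 2) = 0.
  apply/eqP; rewrite -sqrf_eq0 sin2cos2.
  have dd : d / 2 *+ 2 = d by rewrite -mulr_natr divfK ?pnatr_eq0.
  have := cos_mulr2n (d / 2); rewrite dd cd1 mulr2n.
  by move=> h; apply/eqP; lra.
have dlt : `|d| / 2 < pi.
  by rewrite ltr_pdivrMr// mulr_natr ltr_norml; apply/andP; rewrite /d; split; lra.
have sd : sin (`|d| / 2) = 0.
  by have [_|_] := ger0P d => //; rewrite mulNr sinN sd0 oppr0.
apply/eqP; rewrite -normr_eq0 -[_ == _]negbK; apply/negP => d0.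
have /sin_gt0_pi : 0 < `|d| / 2 < pi.
  by rewrite dlt andbT divr_gt0// lt_neqAle eq_sym d0 normr_ge0.
by rewrite sd ltxx.
Qed.

Lemma cis_surj x : sqn x = 1 -> exists2 a, a \in `[0, pi *+ 2[ & x = cis a.
Proof.
case: x => a b; rewrite /sqn /= => ab1.
have a1 : -1 <= a <= 1.
  by have := sqr_ge0 b => b2; apply/andP; split; nra.
have sE : 1 - a ^+ 2 = b ^+ 2 by rewrite -ab1; ring.
have pi0 := @pi_gt0 R.
have [b0|b0] := leP 0 b.
  exists (acos a); rewrite ?in_itv /= ?acos_ge0//.
    by apply: le_lt_trans (acos_lepi a1) _; rewrite mulr2n ltrDr.
  by rewrite /cis acosK ?in_itv// sin_acos// sE sqrtr_sqr ger0_norm.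
exists (pi *+ 2 - acos a).
  rewrite in_itv /= subr_ge0 (le_trans (acos_lepi a1)) ?mulr2n ?lerDl ?ltW//=.
  (* The angle is below 2 pi because a = 1 would force b = 0. *)
  rewrite gtrBl acos_gt0//; case/andP: a1 => -> /=; rewrite le_eqVlt => /orP[/eqP a1|//].
  by move: sE; rewrite a1 expr1n subrr => /esym/eqP; rewrite sqrf_eq0 (lt_eqF b0).
rewrite /cis [pi *+ 2 - _]addrC cosD2pi sinD2pi cosN sinN acosK ?in_itv//.
by rewrite sin_acos// sE sqrtr_sqr ltr0_norm// opprK.
Qed.

End Angles.

(** * Integration over a cube of angles *)

Section BoxIntegral.
Context {R : realType}.

(** Half-open, so that each point of a torus has exactly one vector of angles in it. It is the
    difference of two open sets, hence Borel. *)
Definition box (d : nat) : set 'rV[R]_d :=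
  [set x | forall i, x 0 i \in `[0, pi *+ 2[].

Lemma borel_box d : borel_Rn (@box d).
Proof.
pose G := [set U : set 'rV[R]_d | open U].
pose A : set 'rV[R]_d := [set x | forall i, (x 0 i < pi *+ 2)%R].
pose B : set 'rV[R]_d := [set x | exists i, (x 0 i < 0)%R].
have cvx (x : 'rV[R]_d) i : (fun y : 'rV[R]_d => y 0 i) @ x --> x 0 i.
  exact: coord_continuous.
have oA : open A.
  rewrite openE => x Ax; rewrite /interior.
  have H i : \forall y \near x, ((y : 'rV[R]_d) 0 i < pi *+ 2)%R.
    exact: cvgr_lt (cvx x i) _ (Ax i).
  exact: (filter_forall _ H).
have oB : open B.
  rewrite openE => x [i xi]; rewrite /interior.
  have : \forall y \near x, ((y : 'rV[R]_d) 0 i < 0)%R.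
    exact: cvgr_lt (cvx x i) _ xi.
  by apply: filterS => y; exists i.
have -> : @box d = A `\` B.
  apply/seteqP; split => [x xbox|x [Ax nBx] i].
    split=> [i|]; first by have := xbox i; rewrite in_itv/= => /andP[].
    by case=> i; have := xbox i; rewrite in_itv/= [x 0 i < 0]ltNge => /andP[-> _].
  rewrite in_itv/= Ax andbT leNgt; apply/negP => xi; apply: nBx; by exists i.
apply: (@measurableD _ (g_sigma_algebraType G)); exact: sub_sigma_algebra.
Qed.

Local Open Scope ereal_scope.

Lemma integral_box d (s : R) : (0 <= s)%R ->
  integral_Rn (fun x : 'rV[R]_d => if x \in @box d then s%:E else 0) =
  (s * (pi *+ 2) ^+ d)%:E.
Proof.
elim: d s => [|d IH] s s0 /=.
  by rewrite expr0 mulr1 mem_set// => -[].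
have boxS (x : R) (y : 'rV[R]_d) : ((row_mx x%:M y : 'rV_(1 + d)) \in @box d.+1) =
    (x \in `[0%R, pi *+ 2[%R) && (y \in @box d).
  apply/idP/andP => [|[xI yI]].
    move=> /set_mem xybox.
    have H (i : 'I_(1 + d)) : row_mx (x%:M : 'rV_1) y ord0 i \in `[0%R, pi *+ 2[%R := xybox i.
    split.
      by have := H (lshift d ord0); rewrite row_mxEl mxE eqxx.
    by apply/mem_set => i; have := H (rshift 1 i); rewrite row_mxEr.
  apply/mem_set => i.
  suff : row_mx (x%:M : 'rV_1) y ord0 (i : 'I_(1 + d)) \in `[0%R, pi *+ 2[%R by [].
  case: (@split_ordP 1 d i) => i' ->.
    by rewrite row_mxEl (ord1 i') mxE eqxx.
  by rewrite row_mxEr; exact: (set_mem yI).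
transitivity (\int[@lebesgue_measure R]_(x in `[0%R, (pi *+ 2)%R[%classic)
    (cst ((s * (pi *+ 2) ^+ d)%R%:E) x)).
  rewrite [RHS]integral_mkcond; apply: eq_integral => x _.
  rewrite /patch mem_setE.
  under eq_fun do rewrite boxS.
  case: (x \in _) => /=; first exact: IH.
  (* For [x] outside the interval the inner integrand is 0: the case s = 0 of the induction
     hypothesis. *)
  have E0 := IH 0%R (lexx _); rewrite mul0r in E0; rewrite -[RHS]/(0%R%:E) -E0.
  by congr integral_Rn; apply/funext => y; case: ifP.
rewrite integral_cst; last exact: measurable_itv.
have mI : lebesgue_measure (`[0%R, (pi *+ 2)%R[%classic : set R) = (pi *+ 2)%R%:E.
  by rewrite lebesgue_measure_itv /= lte_fin mulrn_wgt0 ?pi_gt0// sube0.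
transitivity ((s * (pi *+ 2) ^+ d)%R%:E * (pi *+ 2)%R%:E).
  by congr (_ * _); exact: mI.
by rewrite -EFinM exprSr mulrA.
Qed.

End BoxIntegral.

(** * A diagonal matrix minus a rank-one matrix *)

Section Determinant.
Context {R : comUnitRingType}.

(** The matrix determinant lemma with cleared denominators; entries of [r] may be zero or
    noninvertible. *)
Lemma det_diag_sub_rank1 n (r : 'rV[R]_n) :
  \det (diag_mx r - r^T *m r) = (1 - \sum_i r 0 i) * \prod_i r 0 i.
Proof.
pose e : 'cV[R]_n := const_mx 1.
have De : diag_mx r *m e = r^T.
  by apply/matrixP => i j; rewrite mul_diag_mx !mxE mulr1 ord1.
have re : r *m e = (\sum_i r 0 i)%:M.
  apply/matrixP => i j; rewrite !ord1 !mxE eqxx mulr1n.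
  by apply: eq_bigr => p _; rewrite mxE mulr1.
(* Two block triangular reductions of the same bordered matrix. *)
pose M := block_mx (1%:M : 'M[R]_1) r r^T (diag_mx r).
transitivity (\det M).
  have -> : M = block_mx 1%:M 0 r^T 1%:M *m block_mx 1%:M r 0 (diag_mx r - r^T *m r).
    by rewrite mulmx_block !mul1mx !mulmx1 !mul0mx !addr0 [r^T *m r + _]addrC subrK.
  by rewrite det_mulmx det_lblock det_ublock !det1 !mul1r.
have E : M *m block_mx 1%:M 0 (- e) 1%:M =
    block_mx (1 - \sum_i r 0 i)%:M r 0 (diag_mx r).
  rewrite mulmx_block !mulmx1 !mulmx0 !mulmxN De re !add0r subrr.
  by rewrite raddfB.
have := congr1 determinant E.
by rewrite det_mulmx det_lblock det_ublock !det1 !mulr1 det_scalar1 det_diag.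
Qed.

End Determinant.

(** * A chart of the torus and its Gram determinant *)

Section TorusVolume.
Context {R : realType} {n : nat}.
Variable u : 'I_n.+1 -> R.
Hypothesis u_gt0 : forall m, 0 < u m.
Hypothesis u_sum : \sum_m u m = 1.
Implicit Types (x y : 'rV[R]_n) (m : 'I_n.+1) (i j : 'I_n).
Local Open Scope complex_scope.

Definition angle x m : R := if unlift ord0 m is Some i then x 0 i else 0.

(** The section of unit norm whose coordinate z_0 is a positive real. *)
Definition torus_chart x : cvec R n :=
  of_co (fun m => (Num.sqrt (u m))%:C * cis (angle x m)).

Local Notation F := torus_chart.

Lemma angle0 x : angle x ord0 = 0.
Proof. by rewrite /angle unlift_none. Qed.

Lemma angle_lift x i : angle x (lift ord0 i) = x 0 i.
Proof. by rewrite /angle liftK. Qed.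

Lemma cnorm2_torus_chart x m : cnorm2 (F x) m = u m.
Proof.
by rewrite cnorm2E of_coK sqnM sqn_cis sqn_real mulr1 sqr_sqrtr// ltW.
Qed.

Lemma nsq_torus_chart x : nsq (F x) = 1.
Proof. by rewrite /nsq -u_sum; apply: eq_bigr => m _; exact: cnorm2_torus_chart. Qed.

Lemma torus_chart_neq0 x : F x != 0.
Proof. by rewrite -nsq_gt0 nsq_torus_chart ltr01. Qed.

Lemma linear_angle m : linear (angle^~ m).
Proof.
by move=> a x y; rewrite /angle; case: unliftP => [i _|_]; rewrite ?mxE// scaler0 addr0.
Qed.

Lemma continuous_angle m : continuous (angle^~ m).
Proof.
rewrite /angle; case: (unlift ord0 m) => [i|]; last exact: cst_continuous.
exact: coord_continuous.
Qed.

Lemma iter_diff_on_torus_chart p U : iter_diff_on p U F.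
Proof.
have Da m : iter_diff_on p U (angle^~ m).
  by apply: iter_diff_on_lin; [exact: linear_angle|exact: continuous_angle].
apply: iter_diff_on_cvec => m.
- rewrite (_ : (fun x => _) = fun x => Num.sqrt (u m) * cos (angle x m)); last first.
    by apply/funext => x; rewrite -[LHS]/(complex.Re (co (F x) m)) of_coK !complexE/=; ring.
  apply: iter_diff_onM; first exact: iter_diff_on_cst.
  exact: (iter_diff_on_comp (O := setT) _ (iter_diff_on_sincos p).2 (Da m)).
- rewrite (_ : (fun x => _) = fun x => Num.sqrt (u m) * sin (angle x m)); last first.
    by apply/funext => x; rewrite -[LHS]/(complex.Im (co (F x) m)) of_coK !complexE/=; ring.
  apply: iter_diff_onM; first exact: iter_diff_on_cst.
  exact: (iter_diff_on_comp (O := setT) _ (iter_diff_on_sincos p).1 (Da m)).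
Qed.

Definition torus_tangent x i : cvec R n :=
  of_co (fun m => (m == lift ord0 i)%:R%:C * ('i * co (F x) m)).

Lemma co_torus_tangent x i m :
  co (torus_tangent x i) m = (m == lift ord0 i)%:R%:C * ('i * co (F x) m).
Proof. exact: of_coK. Qed.

Lemma derive_torus_chart x i : 'D_(delta_mx 0 i) F x = torus_tangent x i.
Proof.
apply: derive_val.
have Da m : is_derive x (delta_mx 0 i : 'rV[R]_n) (angle^~ m) (m == lift ord0 i)%:R.
  have [cm lm] := (@continuous_angle m, @linear_angle m).
  pose f : {linear 'rV[R]_n -> R} := HB.pack (angle^~ m) (GRing.isLinear.Build _ _ _ _ _ lm).
  have df : differentiable (angle^~ m) x := @linear_differentiable R _ _ f x cm.
  apply: DeriveDef; first exact: diff_derivable.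
  rewrite deriveE// (@diff_lin R _ _ f x cm) /f /= /angle.
  case: unliftP => [j ->|->]; last by rewrite (negbTE (neq_lift _ _)).
  by rewrite mxE eqxx /= (inj_eq (@lift_inj _ _)).
have Dcos s m : is_derive x (delta_mx 0 i : 'rV[R]_n) (fun x => s * cos (angle x m))
    (- s * sin (angle x m) * (m == lift ord0 i)%:R).
  apply: is_derive_congr (is_derive_times (is_derive_cst s _ _) (is_derive_cos_comp (Da m))) _.
  by rewrite /cst; ring.
have Dsin s m : is_derive x (delta_mx 0 i : 'rV[R]_n) (fun x => s * sin (angle x m))
    (s * cos (angle x m) * (m == lift ord0 i)%:R).
  apply: is_derive_congr (is_derive_times (is_derive_cst s _ _) (is_derive_sin_comp (Da m))) _.
  by rewrite /cst; ring.
apply: is_derive_cvec => m.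
- rewrite (_ : (fun x => _) = fun x => Num.sqrt (u m) * cos (angle x m)); last first.
    by apply/funext => y; rewrite -[LHS]/(complex.Re (co (F y) m)) of_coK !complexE/=; ring.
  apply: is_derive_congr (Dcos _ m) _.
  rewrite -[RHS]/(complex.Re (co (torus_tangent x i) m)) !of_coK !complexE /=; ring.
- rewrite (_ : (fun x => _) = fun x => Num.sqrt (u m) * sin (angle x m)); last first.
    by apply/funext => y; rewrite -[LHS]/(complex.Im (co (F y) m)) of_coK !complexE/=; ring.
  apply: is_derive_congr (Dsin _ m) _.
  rewrite -[RHS]/(complex.Im (co (torus_tangent x i) m)) !of_coK !complexE /=; ring.
Qed.

Lemma cdot_co (v w : cvec R n) : cdot v w = \sum_m complex.Re (co v m * (co w m)^*).
Proof. by apply: eq_bigr => m _; rewrite !complexE/=; ring. Qed.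

Lemma cdot_torus_tangent x i w :
  cdot (torus_tangent x i) w =
  complex.Re ('i * co (F x) (lift ord0 i) * (co w (lift ord0 i))^*).
Proof.
rewrite cdot_co (bigD1 (lift ord0 i))// big1 => [|m mi].
  by rewrite co_torus_tangent eqxx mul1r [LHS]addr0.
by move: mi; rewrite co_torus_tangent => /negbTE ->; rewrite !mul0r.
Qed.

Lemma cdotC (v w : cvec R n) : cdot v w = cdot w v.
Proof. by apply: eq_bigr => m _; ring. Qed.

(** The i-th tangent vector is orthogonal to z and has product u_i with 'i z. Removing this
    component along the complex line of z produces the rank-one term. *)
Lemma gram_torus_chart x :
  let r : 'rV[R]_n := \row_i u (lift ord0 i) in
  gram F x = 2 *: (diag_mx r - r^T *m r).
Proof.
move=> r; apply/matrixP => i j; rewrite !mxE big_ord1 !mxE !derive_torus_chart.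
have FF : cdot (F x) (F x) = 1.
  rewrite -(nsq_torus_chart x); apply: eq_bigr => m _.
  by rewrite /cnorm2 !expr2.
have uE m : complex.Re (co (F x) m * (co (F x) m)^*) = u m.
  by rewrite mulCconj -cnorm2E cnorm2_torus_chart.
have uI m : complex.Im (co (F x) m * (co (F x) m)^*) = 0.
  by rewrite mulCconj.
have t0 p : cdot (torus_tangent x p) (F x) = 0.
  by rewrite cdot_torus_tangent -mulrA ReM uI mulr0 subr0 mul0r.
have t1 p : cdot (torus_tangent x p) (cscale 'i (F x)) = u (lift ord0 p).
  rewrite cdot_torus_tangent co_cscale conjCM.
  rewrite (_ : _ * _ * _ = ('i * 'i^*) *
    (co (F x) (lift ord0 p) * (co (F x) (lift ord0 p))^*)); last by ring.
  by rewrite !mulCconj -cnorm2E cnorm2_torus_chart /sqn /=; ring.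
have t2 : cdot (torus_tangent x i) (torus_tangent x j) = (i == j)%:R * u (lift ord0 i).
  rewrite cdot_torus_tangent co_torus_tangent (inj_eq (@lift_inj _ _)).
  rewrite (_ : complex.Re _ = (i == j)%:R *
      complex.Re (co (F x) (lift ord0 i) * (co (F x) (lift ord0 i))^*)).
    by rewrite uE.
  by rewrite !complexE/=; ring.
rewrite /fs_metric FF t0 t2 [cdot (cscale _ _) _]cdotC !t1 expr1n divr1.
have [<-|ij] := eqVneq i j; rewrite ?mulr1n ?mulr0n; ring.
Qed.

(** The factor 1 - \sum_i r_i of the determinant is u_0, which makes the result symmetric in all n +
    1 coordinates. *)
Lemma det_gram_torus_chart x : \det (gram F x) = 2 ^+ n * \prod_m u m.
Proof.
rewrite gram_torus_chart detZ det_diag_sub_rank1; congr (_ * _).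
rewrite [RHS]big_ord_recl; congr (_ * _); last by apply: eq_bigr => i _; rewrite mxE.
rewrite -u_sum big_ord_recl; under [in X in _ - X]eq_bigr do rewrite mxE.
by rewrite addrK.
Qed.

(** A fibre of the moment map in homogeneous form: no coordinate is singled out and no division
    occurs. *)
Definition torus : set (CP R n) :=
  [set q | forall m, cnorm2 (rep q) m = u m * nsq (rep q)].

Lemma torus_pt (z : cvec R n) : z != 0 ->
  torus (pt z) <-> forall m, cnorm2 z m = u m * nsq z.
Proof.
move=> z0; have [a a0 zE] := rep_pt z0.
have a1 : sqn a != 0 by rewrite gt_eqF// sqn_gt0.
rewrite /torus /= [in X in _ <-> X]zE; split => H m; have := H m.
  by rewrite cnorm2_cscale nsq_cscale => ->; rewrite mulrCA.
by rewrite cnorm2_cscale nsq_cscale mulrCA; exact: mulfI.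
Qed.

Lemma pt_torus_chart_inj x y : box x -> box y -> pt (F x) = pt (F y) -> x = y.
Proof.
move=> bx by_ /(pt_eqP (torus_chart_neq0 x) (torus_chart_neq0 y))[a yE].
have su m : (Num.sqrt (u m))%:C != 0 :> R[i].
  by rewrite eq_complex /= eqxx andbT gt_eqF// sqrtr_gt0.
have E m : cis (angle y m) = a * cis (angle x m).
  apply: (mulfI (su m)); rewrite mulrCA -[LHS](of_coK (fun m => _%:C * cis (angle y m))).
  by rewrite -/(F y) yE co_cscale of_coK.
(* Both charts give z_0 the angle 0, which fixes the scalar. *)
have a1 : a = 1 by have := E ord0; rewrite !angle0 cis0 mulr1.
apply/rowP => i; apply: cis_inj; [exact: bx|exact: by_|].
by have := E (lift ord0 i); rewrite !angle_lift a1 mul1r.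
Qed.

Lemma torus_chart_surj q : torus q -> exists x, box x /\ q = pt (F x).
Proof.
move=> Tq; set z := rep q; have z0 : z != 0 := rep_neq0 q.
have N0 : 0 < nsq z by rewrite nsq_gt0.
pose phase m := co z m * (Num.sqrt (u m * nsq z))^-1%:C.
have sqn_phase m : sqn (phase m) = 1.
  rewrite sqnM sqn_real exprVn sqr_sqrtr; last by rewrite ltW// mulr_gt0.
  by rewrite -cnorm2E (Tq m) divff// gt_eqF// mulr_gt0.
have /choice[a aP] (i : 'I_n) : exists a, (a \in `[0, pi *+ 2[) /\
    phase (lift ord0 i) * (phase ord0)^* = cis a.
  have [|a aI aE] := @cis_surj R (phase (lift ord0 i) * (phase ord0)^*).
    by rewrite sqnM sqnC !sqn_phase mulr1.
  by exists a.
exists (\row_i a i); split => [i|]; first by rewrite mxE; exact: (aP i).1.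
rewrite -(pt_rep q); apply/pt_eqP => //; first exact: torus_chart_neq0.
(* This scalar makes z_0 real positive and the norm 1, as in [torus_chart]. *)
exists ((phase ord0)^* * (Num.sqrt (nsq z))^-1%:C); apply: coP => m.
have -> : co (F (\row_i a i)) m = (Num.sqrt (u m))%:C * (phase m * (phase ord0)^*).
  rewrite of_coK; congr (_ * _); rewrite /angle; case: unliftP => [i ->|->].
    by rewrite mxE (aP i).2.
  by rewrite cis0 mulCconj sqn_phase.
rewrite co_cscale /phase sqrtrM ?(ltW (u_gt0 m))// invfM realCM.
transitivity (co z m * (phase ord0)^* * (Num.sqrt (nsq z))^-1%:C *
   ((Num.sqrt (u m))%:C * (Num.sqrt (u m))^-1%:C)); first by rewrite /phase; ring.
rewrite -realCM divff ?gt_eqF ?sqrtr_gt0// mulr1 /phase; ring.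
Qed.

Lemma is_volume_torus :
  is_volume n torus ((Num.sqrt (2 ^+ n * \prod_m u m) * (pi *+ 2) ^+ n)%:E).
Proof.
exists 1%N, (fun=> setT), (fun=> @box R n), (fun=> F); split.
- by move=> _; split => //; [exact: openT|exact: borel_box].
- move=> _; split => [p|x _].
    by apply: iter_diff_on_Ck; [exact: openT|exact: iter_diff_on_torus_chart].
  split; first exact: torus_chart_neq0.
    apply/torus_pt; first exact: torus_chart_neq0.
    by move=> m; rewrite cnorm2_torus_chart nsq_torus_chart mulr1.
  by rewrite det_gram_torus_chart mulr_gt0 ?exprn_gt0// prodr_gt0.
- move=> q; split => [/torus_chart_surj[x [bx ->]]|[[k x] /= [bx ->]]].
    by exists (ord0, x).
  apply/torus_pt; first exact: torus_chart_neq0.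
  by move=> m; rewrite cnorm2_torus_chart nsq_torus_chart mulr1.
- by move=> k l x y bx by_ /(pt_torus_chart_inj bx by_) ->; rewrite (ord1 k) (ord1 l).
- rewrite big_ord1 -integral_box ?sqrtr_ge0//; congr integral_Rn.
  by apply/funext => x; rewrite det_gram_torus_chart.
Qed.

End TorusVolume.

(** * Swapping two orbits along a symmetric probe *)

Section TorusSwap.
Context {R : realType} {n : nat} (i j k l : 'I_n.+1).
Hypothesis ijkl : uniq [:: i; j; k; l].
Variable u : 'I_n.+1 -> R.
Hypothesis u_gt0 : forall m, 0 < u m.
Hypothesis u_sum : \sum_m u m = 1.
Hypotheses (lt_ij : u i < u j) (lt_jl : u j < u l) (lt_lk : u l < u k).

Let ne := uniq4_neq ijkl.

Definition probe_swap (w : 'I_n.+1 -> R) m : R :=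
  if m == i then w j else if m == j then w i
  else if m == k then w k + (w j - w i)
  else if m == l then w l - (w j - w i) else w m.

Lemma probe_swapE w : [/\ probe_swap w i = w j, probe_swap w j = w i,
  probe_swap w k = w k + (w j - w i) & probe_swap w l = w l - (w j - w i)].
Proof.
have [[/negbTE ji /negbTE ki /negbTE li] [/negbTE kj /negbTE lj /negbTE lk]] := ne.
by rewrite /probe_swap !eqxx ji ki kj li lj lk.
Qed.

Lemma probe_swap_other w m : m != i -> m != j -> m != k -> m != l ->
  probe_swap w m = w m.
Proof. by rewrite /probe_swap => /negbTE-> /negbTE-> /negbTE-> /negbTE->. Qed.

Lemma probe_swapK w : probe_swap (probe_swap w) = w.
Proof.
have [wi wj wk wl] := probe_swapE w.
apply/funext => m; rewrite {1}/probe_swap wi wj wk wl.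
case: eqP => [->//|/eqP mi]; case: eqP => [->//|/eqP mj].
case: eqP => [->|/eqP mk]; first by ring.
case: eqP => [->|/eqP ml]; first by ring.
exact: probe_swap_other.
Qed.

(** Stated for any [w] and [t], to serve both for [u] at time 1 and for its mirror image at time
    -1. *)
Lemma torus_flow c eps t w q : 0 < eps -> torus w q ->
  eps < w k - w i -> eps < w l - w j ->
  cos (t * (c * flat 0 (w k - w i - eps) * flat 0 (w l - w j - eps) / 2)) = 0 ->
  torus (probe_swap w) (flowCP i j k l c eps t q).
Proof.
move=> eps0 Tq hk hl c0; set z := rep q; have z0 : z != 0 := rep_neq0 q.
have N0 : nsq z != 0 by rewrite nsq_eq0.
have gA : gapA i k z = w k - w i.
  by rewrite /gapA (Tq k) (Tq i) -mulrBl mulfK.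
have gB : gapB j l z = w l - w j.
  by rewrite /gapB (Tq l) (Tq j) -mulrBl mulfK.
have gap : (eps < gapA i k z) && (eps < gapB j l z) by rewrite gA gB hk hl.
have rE : cos (t * rate i j k l c eps z) = 0 by rewrite /rate gA gB.
apply/torus_pt; first exact: flow_neq0.
have [wi wj wk wl] := probe_swapE w.
have [fi fj fk fl] := cnorm2_flow_swap ijkl eps0 gap rE.
move=> m; rewrite nsq_flow//.
have [->|mi] := eqVneq m i; first by rewrite fi wi (Tq j).
have [->|mj] := eqVneq m j; first by rewrite fj wj (Tq i).
have [->|mk] := eqVneq m k.
  by rewrite fk wk (Tq k) (Tq j) (Tq i) -/z; ring.
have [->|ml] := eqVneq m l.
  by rewrite fl wl (Tq l) (Tq j) (Tq i) -/z; ring.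
by rewrite probe_swap_other// -(Tq m) /flow cnorm2_twist_other.
Qed.

Lemma Ham_probe_swap : exists2 phi, Ham phi & phi @` torus u = torus (probe_swap u).
Proof.
(* Half of the smaller gap, so that both cutoff factors are positive on the torus. *)
pose eps := Num.min (u k - u i) (u l - u j) / 2.
have a0 : 0 < u k - u i by rewrite subr_gt0 (lt_trans lt_ij)// (lt_trans lt_jl).
have b0 : 0 < u l - u j by rewrite subr_gt0.
have m0 : 0 < Num.min (u k - u i) (u l - u j) by rewrite lt_min a0 b0.
have eps0 : 0 < eps by rewrite divr_gt0.
have epsm : eps < Num.min (u k - u i) (u l - u j).
  by rewrite gtr_pMr// invf_lt1// ltr1n.
have hk : eps < u k - u i by rewrite (lt_le_trans epsm)// ge_min lexx.
have hl : eps < u l - u j by rewrite (lt_le_trans epsm)// ge_min lexx orbT.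
pose f := flat 0 (u k - u i - eps) * flat 0 (u l - u j - eps).
have f0 : 0 < f by rewrite mulr_gt0// flat_gt0// subr_gt0.
(* The rate on the torus is then pi / 2, and its cosine vanishes at times 1 and -1. *)
pose c := pi / f.
have cf : c * flat 0 (u k - u i - eps) * flat 0 (u l - u j - eps) / 2 = pi / 2.
  by rewrite -[c * _ * _]mulrA -/f /c divfK// gt_eqF.
exists (flowCP i j k l c eps 1); first exact: Ham_flowCP.
have [ui uj uk ul] := probe_swapE u.
(* The mirror torus has the same gaps, hence the same rate: flowing back from it proves
   surjectivity. *)
have ek : probe_swap u k - probe_swap u i = u k - u i by rewrite uk ui; ring.
have el : probe_swap u l - probe_swap u j = u l - u j by rewrite ul uj; ring.
apply/seteqP; split => [_ [q Tq <-]|q Tq].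
  by apply: torus_flow => //; rewrite cf mul1r cos_pihalf.
exists (flowCP i j k l c eps (- 1) q).
  rewrite -(probe_swapK u); apply: torus_flow => //; rewrite ?ek ?el//.
  by rewrite cf mulN1r cosN cos_pihalf.
by rewrite flowCP_add// subrr flowCP0.
Qed.

Lemma probe_swap_gt0 m : 0 < probe_swap u m.
Proof.
have [ui uj uk ul] := probe_swapE u.
have [->|mi] := eqVneq m i; first by rewrite ui.
have [->|mj] := eqVneq m j; first by rewrite uj.
have [->|mk] := eqVneq m k.
  by rewrite uk addr_gt0// subr_gt0.
have [->|ml] := eqVneq m l.
  by rewrite ul; move: lt_jl (u_gt0 i); lra.
by rewrite probe_swap_other.
Qed.

Lemma probe_swap_sum : \sum_m probe_swap u m = 1.
Proof.
rewrite -u_sum !(sum_four ijkl); have [-> -> -> ->] := probe_swapE u.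
congr (_ + _); first by ring.
by apply: eq_bigr => m /and4P[? ? ? ?]; rewrite probe_swap_other.
Qed.

Lemma probe_swap_prod : \prod_m probe_swap u m < \prod_m u m.
Proof.
have [[ji ki li] [kj lj lk]] := ne.
have prod_four (F : 'I_n.+1 -> R) : \prod_m F m = F i * F j * F k * F l *
    \prod_(m | [&& m != i, m != j, m != k & m != l]) F m.
  rewrite (bigD1 i)//= (bigD1 j)//= (bigD1 k)/= ?ki// (bigD1 l)/= ?li ?lj//.
  by rewrite !mulrA; congr (_ * _); apply: eq_bigl => m; rewrite -!andbA.
rewrite !prod_four; have [-> -> -> ->] := probe_swapE u.
rewrite [X in _ * X < _](eq_bigr u); last first.
  by move=> m /and4P[? ? ? ?]; rewrite probe_swap_other.
rewrite ltr_pM2r; last by apply: prodr_gt0 => m _.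
rewrite -!mulrA mulrCA ltr_pM2l// ltr_pM2l//.
move: lt_ij lt_jl lt_lk (u_gt0 i); nra.
Qed.

Lemma torus_not_minimizing : ~ hamiltonian_volume_minimizing (torus u).
Proof.
have [phi Hphi phiT] := Ham_probe_swap.
move=> /(_ phi Hphi _ _ (is_volume_torus u_gt0 u_sum)).
rewrite phiT => /(_ _ (is_volume_torus probe_swap_gt0 probe_swap_sum)).
rewrite lee_fin leNgt => /negP; apply.
have pin : 0 < (pi *+ 2) ^+ n :> R by rewrite exprn_gt0// mulrn_wgt0// pi_gt0.
rewrite ltr_pM2r// ltr_sqrt; last by rewrite mulr_gt0 ?exprn_gt0// prodr_gt0.
by rewrite ltr_pM2l ?exprn_gt0// probe_swap_prod.
Qed.

End TorusSwap.

(** * Generic points of the moment simplex *)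

Section HomogeneousMoment.
Context {R : realType} {n : nat}.
Implicit Types (p v : 'rV[R]_n) (m : 'I_n.+1).

Definition homog p m : R :=
  if unlift ord0 m is Some i then p 0 i else 1 - \sum_i p 0 i.

Lemma homog0 p : homog p ord0 = 1 - \sum_i p 0 i.
Proof. by rewrite /homog unlift_none. Qed.

Lemma homog_lift p i : homog p (lift ord0 i) = p 0 i.
Proof. by rewrite /homog liftK. Qed.

Lemma homog_sum p : \sum_m homog p m = 1.
Proof.
rewrite big_ord_recl homog0; under [in X in _ + X]eq_bigr do rewrite homog_lift.
by rewrite subrK.
Qed.

Lemma moment_fiber p : @moment R n @^-1` [set p] = torus (homog p).
Proof.
apply/seteqP; split => q /=.
- have N0 : nsq (rep q) != 0 by rewrite nsq_eq0 rep_neq0.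
  move=> <-; have E i : cnorm2 (rep q) (lift ord0 i) = moment q 0 i * nsq (rep q).
    by rewrite mxE -/(nsq _) divfK.
  move=> m; case: (unliftP ord0 m) => [i ->|->]; first by rewrite homog_lift.
  rewrite homog0 mulrBl mul1r mulr_suml; under eq_bigr do rewrite -E.
  by rewrite /nsq big_ord_recl addrK.
- move=> Tq; have N0 : nsq (rep q) != 0 by rewrite nsq_eq0 rep_neq0.
  apply/rowP => i; rewrite mxE -/(rep q) -/(nsq (rep q)).
  by rewrite (Tq (lift ord0 i)) homog_lift mulfK.
Qed.

Lemma cvg_line (V : normedModType R) (p v : V) : p + t *: v @[t --> (0 : R)] --> p.
Proof.
rewrite -[X in _ --> X]addr0 -(scale0r v).
apply: cvgD; first exact: cvg_cst.
by apply: cvgZr_tmp; exact: cvg_id.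
Qed.

(** An interior point can be moved a little in a direction that decreases the m-th homogeneous
    coordinate, and this coordinate is still nonnegative afterwards. *)
Lemma homog_gt0 p m : (0 < n)%N -> (simplex R n)° p -> 0 < homog p m.
Proof.
move=> n0 ip.
have line v : exists2 t : R, 0 < t & simplex R n (p + t *: v).
  have St : \forall t \near (0 : R)^'+, simplex R n (p + t *: v).
    have H := cvg_at_right_filter (@cvg_line _ p v); exact: (H (simplex R n) ip).
  have [t [t0 ?]] := filter_ex (filterI (nbhs_right_gt 0) St).
  by exists t.
case: (unliftP ord0 m) => [i ->|->].
  have [t t0 [/(_ i) + _]] := line (- delta_mx 0 i).
  by rewrite homog_lift !mxE !eqxx /=; lra.
have [t t0 [_]] := line (delta_mx 0 (Ordinal n0)).
rewrite homog0; under eq_bigr do rewrite !mxE eqxx /=.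
rewrite big_split /= -mulr_sumr [X in t * X](_ : _ = 1) ?mulr1; first by lra.
rewrite (bigD1 (Ordinal n0))//= big1 => [|i /negbTE->//].
by rewrite addr0.
Qed.

Lemma continuous_homog m : continuous (homog^~ m).
Proof.
have Dcoord i : iter_diff_on 0 (setT : set 'rV[R]_n) (fun p => p 0 i).
  apply: iter_diff_on_lin => [b x y|]; first by rewrite !mxE.
  exact: coord_continuous.
suff : iter_diff_on 0 (setT : set 'rV[R]_n) (homog^~ m).
  by case=> D _ p; exact/differentiable_continuous/D.
rewrite /homog; case: (unlift ord0 m) => [i|]; first exact: Dcoord.
apply: iter_diff_onB; first exact: iter_diff_on_cst.
exact: iter_diff_on_sum.
Qed.

Lemma near_affine_neq0 (d w : R) : w != 0 -> \forall t \near 0^', d + t * w != 0.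
Proof.
move=> w0; have [->|d0] := eqVneq d 0.
  near=> t; rewrite add0r mulf_neq0//; near: t; exact: nbhs_dnbhs_neq.
apply: nbhs_dnbhs.
have cv : d + t * w @[t --> (0 : R)] --> d := @cvg_line R d w.
by near=> t; near: t; exact: (cvgr_neq0 _ cv).
Unshelve. all: by end_near. Qed.

(** The direction (1, 2, ..., n) gives the homogeneous coordinates the slopes 1, ..., n and - (1 +
    ... + n), which are pairwise distinct; two coordinates thus agree for at most one [t]. *)
Lemma homog_line p t m :
  homog (p + t *: \row_i i.+1%:R) m =
  homog p m + t * (if unlift ord0 m is Some i then i.+1%:R
                   else - \sum_(i < n) i.+1%:R).
Proof.
rewrite /homog; case: (unlift ord0 m) => [i|]; first by rewrite !mxE.
under eq_bigr do rewrite !mxE.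
by rewrite big_split /= -mulr_sumr; ring.
Qed.

Lemma near_homog_neq p m m' : m != m' -> \forall t \near 0^',
  homog (p + t *: \row_i i.+1%:R) m != homog (p + t *: \row_i i.+1%:R) m'.
Proof.
set w := fun m : 'I_n.+1 => if unlift ord0 m is Some i then i.+1%:R
                   else - \sum_(i < n) i.+1%:R : R.
move=> mm'; have wm : w m - w m' != 0.
  have s0 : 0 <= \sum_(i < n) i.+1%:R :> R by apply: sumr_ge0.
  rewrite subr_eq0 /w; move: mm'.
  case: (unliftP ord0 m) => [i ->|->]; case: (unliftP ord0 m') => [i' ->|->] //.
  - by rewrite (inj_eq (@lift_inj _ _)) eqr_nat eqSS.
  - by move=> _; rewrite gt_eqF// (le_lt_trans _ (ltr0Sn _ _))// oppr_le0.
  - by move=> _; rewrite lt_eqF// (le_lt_trans _ (ltr0Sn _ _))// oppr_le0.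
have := near_affine_neq0 (homog p m - homog p m') wm.
apply: filterS => t; rewrite !homog_line -/(w m) -/(w m') => /eqP h.
by apply/eqP => e; apply: h; rewrite mulrBr; lra.
Qed.

Definition generic : set 'rV[R]_n :=
  [set p | (simplex R n)° p /\ forall m m', m != m' -> homog p m != homog p m'].

Lemma open_generic : open generic.
Proof.
rewrite openE => p [ip dp]; rewrite /interior.
have ii : \forall q \near p, (simplex R n)° q.
  exact: (open_nbhs_nbhs (conj (@open_interior _ _) ip)).
have dd (mm : 'I_n.+1 * 'I_n.+1) : \forall q \near p, mm.1 != mm.2 ->
    homog q mm.1 != homog q mm.2.
  case: mm => m m' /=; have [->|mm'] := eqVneq m m'; first by near=> q.
  have cv : homog q m - homog q m' @[q --> p] --> homog p m - homog p m'.
    exact: (cvgB (@continuous_homog m p) (@continuous_homog m' p)).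
  have h0 : homog p m - homog p m' != 0 by rewrite subr_eq0 dp.
  apply: filterS (cvgr_neq0 _ cv h0) => q.
  by rewrite subr_eq0.
apply: filterS2 ii (filter_forall _ dd) => q iq dq; split => // m m'; exact: (dq (m, m')).
Unshelve. all: by end_near. Qed.

Lemma generic_dense : (simplex R n)° `<=` closure generic.
Proof.
move=> p ip B Bp.
have line (A : set 'rV[R]_n) : nbhs p A ->
    \forall t \near (0 : R)^', A (p + t *: \row_i i.+1%:R).
  by move=> Ap; apply: nbhs_dnbhs; exact: (@cvg_line _ p _ A Ap).
have ii : nbhs p (simplex R n)°.
  exact: (open_nbhs_nbhs (conj (@open_interior _ _) ip)).
have dd (mm : 'I_n.+1 * 'I_n.+1) : \forall t \near (0 : R)^', mm.1 != mm.2 ->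
    homog (p + t *: \row_i i.+1%:R) mm.1 != homog (p + t *: \row_i i.+1%:R) mm.2.
  case: mm => m m' /=; have [->|mm'] := eqVneq m m'; first by near=> t.
  by apply: filterS (near_homog_neq p mm').
have [t [[Bt it] dt]] := filter_ex (filterI (filterI (line _ Bp) (line _ ii))
  (filter_forall _ dd)).
exists (p + t *: \row_i i.+1%:R); split => //; split => // m m'; exact: (dt (m, m')).
Unshelve. all: by end_near. Qed.

Lemma generic_not_minimizing p : (3 <= n)%N -> generic p ->
  ~ hamiltonian_volume_minimizing (torus (homog p)).
Proof.
move=> n3 [ip dp].
have u_gt0 m : 0 < homog p m by apply: homog_gt0 => //; exact: leq_trans n3.
pose u := homog p; pose leu m m' := u m <= u m'.
(* Any four coordinates will do, and 3 <= n provides them. Sorted by increasing value of [u], they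
   are named i, j, l, k in this order. *)
pose s : seq 'I_n.+1 := [:: inord 0; inord 1; inord 2; inord 3].
have us : uniq s.
  rewrite -(map_inj_uniq val_inj) /= !inordK// (leq_trans _ (n3 : (4 <= n.+1)%N))//.
have : sorted leu (sort leu s) by apply: sort_sorted => m m'; exact: le_total.
have : uniq (sort leu s) by rewrite sort_uniq.
have : size (sort leu s) = 4%N by rewrite size_sort.
case: (sort leu s) => [|i [|j [|l [|k [|? ?]]]]] // _ U.
rewrite /= andbT => /and3P[ij jl lk].
move: (U); rewrite /= !inE !negb_or => /and4P[/and3P[nij _ _] /andP[njl _] nlk _].
have ijkl : uniq [:: i; j; k; l].
  by rewrite -(perm_uniq (s1 := [:: i; j; l; k]))// !perm_cons (perm_catC [:: l] [:: k]).
have lt m m' : m != m' -> leu m m' -> u m < u m'.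
  by move=> mm' le; rewrite lt_neqAle dp.
apply: (torus_not_minimizing ijkl u_gt0 (homog_sum p)).
- exact: lt nij ij.
- exact: lt njl jl.
- exact: lt nlk lk.
Qed.

End HomogeneousMoment.

Theorem theorem5 (R : realType) (n : nat) (hn : (3 <= n)%N) :
  exists D : set 'rV[R]_n,
    [/\ open D,
        D `<=` (simplex R n)°,
        (simplex R n)° `<=` closure D &
        forall p, D p ->
          ~ hamiltonian_volume_minimizing (@moment R n @^-1` [set p])].
Proof.
exists (@generic R n); split.
- exact: open_generic.
- by move=> p [].
- exact: generic_dense.
- by move=> p Dp; rewrite moment_fiber; exact: generic_not_minimizing.
Qed.
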